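(* Let $n\ge 1$ and $k\ge 4$ be integers. Then \[ \mathrm{ex}_3(n,\text{Berge-}K_k) = \begin{cases} |T_3(n,k-1)| & \text{if } k\ge 6, \text{ or } k=5 \text{ and } n\ge 6, \text{ or } k=4 \text{ and } n\ge 6, \\[1em] \binom{n}{3} & \text{if } k=5 \text{ and } n\le 4, \text{ or } k=4 \text{ and } n\le 4, \\[1em] 5 & \text{if } k=4 \text{ and } n=5, \\[1em] 9 & \text{if } k=5 \text{ and } n=5. \end{cases} \]
   Context: All graphs and hypergraphs are finite and simple. $T_3(n,m)$ denotes the complete $m$-partite $n$-vertex $3$-uniform hypergraph in which all parts have size $\lfloor n/m\rfloor$ or $\lceil n/m\rceil$ (its hyperedges are all $3$-sets of vertices meeting each part in at most one vertex), and $|T_3(n,m)|$ is its number of hyperedges. A hypergraph $\mathcal{H}$ contains a Berge-$F$ (Berge copy of the graph $F$) if there are an injection $\varphi:V(F)\to V(\mathcal{H})$ and an injection $f:E(F)\to E(\mathcal{H})$ with $\{\varphi(u),\varphi(v)\}\subset f(uv)$ for every edge $uv\in E(F)$; otherwise it is Berge-$F$-free. $\mathrm{ex}_3(n,\text{Berge-}F)$ is the maximum number of hyperedges in an $n$-vertex $3$-uniform Berge-$F$-free hypergraph. *)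

(* Defs.v *)
From mathcomp Require Import all_boot zify.

Set Implicit Arguments.
Unset Strict Implicit.
Unset Printing Implicit Defensive.

(* A simple r-uniform hypergraph with vertex type V is given by its set of     *)
(* hyperedges H : {set {set V}}; a simple graph is the case r = 2.             *)
Definition uniform (V : finType) (r : nat) (H : {set {set V}}) : bool :=
  [forall e in H, #|e| == r].

Definition complete_graph (k : nat) : {set {set 'I_k}} :=
  [set e : {set 'I_k} | #|e| == 2].

(* The injection E(F) -> E(H) is encoded as a function on all vertex sets      *)
(* whose values outside F are irrelevant.                                      *)
Definition contains_berge (V T : finType)
    (F : {set {set V}}) (H : {set {set T}}) : bool :=
  [exists phi : {ffun V -> T}, [exists f : {ffun {set V} -> {set T}},
    [&& injectiveb phi, dinjectiveb f (mem F),
        [forall e in F, f e \in H] & [forall e in F, phi @: e \subset f e]]]].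

Lemma contains_bergeP (V T : finType)
    (F : {set {set V}}) (H : {set {set T}}) :
  reflect (exists (phi : V -> T) (f : {set V} -> {set T}),
             [/\ injective phi, {in F &, injective f},
                 forall e, e \in F -> f e \in H
               & forall e, e \in F -> phi @: e \subset f e])
          (contains_berge F H).
Proof.
apply: (iffP existsP) => [[phi /existsP[f /and4P[i1 /dinjectiveP i2 i3 i4]]]|].
  exists phi, f; split=> //; first exact/injectiveP.
    by move=> e eF; apply: (forall_inP i3).
  by move=> e eF; apply: (forall_inP i4).
case=> phi [f [i1 i2 i3 i4]].
exists (finfun phi); apply/existsP; exists (finfun f); apply/and4P; split.
- by apply/injectiveP => x y; rewrite !ffunE => /i1.
- by apply/dinjectiveP => x y xF yF; rewrite !ffunE; apply: i2.
- by apply/forall_inP => e eF; rewrite ffunE i3.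
- apply/forall_inP => e eF; rewrite ffunE.
  by rewrite (eq_imset _ (ffunE phi)) i4.
Qed.

(* ex_3(n, Berge-F). The maximum ranges over a nonempty family as soon as F    *)
(* has an edge, since the empty hypergraph then qualifies.                     *)
Definition ex3_berge (n : nat) (V : finType) (F : {set {set V}}) : nat :=
  \max_(H : {set {set 'I_n}} | uniform 3 H && ~~ contains_berge F H) #|H|.

(* The parts of T_3(n, m) are the residue classes modulo m; by                 *)
(* card_turan_part they have size floor(n/m) or ceil(n/m).                     *)
Definition turan_part (n m : nat) (j : 'I_m) : {set 'I_n} :=
  [set i : 'I_n | i %% m == j].

Definition turan3 (n m : nat) : {set {set 'I_n}} :=
  [set e : {set 'I_n} |
    (#|e| == 3) && [forall j : 'I_m, #|e :&: turan_part n j| <= 1]].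

Lemma card_turan_part (n m : nat) (j : 'I_m) :
  #|turan_part n j| = n %/ m + (j < n %% m).
Proof.
rewrite -sum1dep_card.
have lt_jm := ltn_ord j; have m_gt0 : 0 < m by apply: leq_ltn_trans lt_jm.
rewrite -(big_mkord (fun i => i %% m == j :> nat) (fun=> 1)).
elim: n => [|n IHn]; first by rewrite big_geq // div0n mod0n ltn0.
rewrite big_mkcond big_nat_recr //= -big_mkcond /= IHn.
have := divn_eq n m; have := ltn_pmod n m_gt0.
set q := n %/ m; set r := n %% m => lt_rm ->.
case: (ltnP r.+1 m) => [lt_r1|ge_r1].
  rewrite -addnS divnMDl // modnMDl divn_small // (modn_small lt_r1).
  by case: eqP; lia.
have -> : q * m + r = q.+1 * m - 1 by lia.
have -> : (q.+1 * m - 1).+1 = q.+1 * m by lia.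
by rewrite mulnK // modnMl; case: eqP; lia.
Qed.

(* Main.v *)
Require Import Defs.
From mathcomp Require Import all_boot zify ring.

Set Implicit Arguments.
Unset Strict Implicit.
Unset Printing Implicit Defensive.

(* A maximum-deficiency set of hyperedges splits a Berge-K_k-free hypergraph:   *)
(* the pairs in its shadow ("blue") are matched into it, and the remaining      *)
(* hyperedges are matched to distinct further pairs ("red").  The red-blue graph *)
(* is K_k-free, and the number of hyperedges is at most the number of red edges *)
(* plus the number of blue triangles.  Zykov symmetrization on weighted vertices *)
(* merges nonadjacent vertices until at most k - 1 are left; merging red pairs  *)
(* as well shows that a monochromatic weighting is optimal, and balancing the   *)
(* weights leads to the Turan hypergraph unless n is small.  In the small cases *)
(* (n <= 8 for k = 4, n <= 6 for k = 5) the vertices are ordered so that each   *)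
(* one has minimum degree among its predecessors, which makes an exhaustive     *)
(* search vertex by vertex short enough to be carried out by computation.       *)

(** * Hall's theorem and the red-blue decomposition *)

(** A Berge clique on a vertex set is a system of distinct representatives for the pairs in it, so
    Hall's theorem governs its absence. A subset [H1] of maximum deficiency gives
    [red_blue_decomposition]: $|H| = |H_1| + |R|$ with [R] a set of red pairs, and no $k$-set has
    all its pairs red or blue. Each hyperedge of [H1] spans a blue triangle, so $|H|$ is at most the
    number of red edges plus blue triangles. That number is then maximized over vertex weightings.
    Merging nonadjacent vertices leaves a clique, hence at most $k-1$ vertices ([weight_le_clique]);
    recolouring this clique all red or all blue loses nothing for one of the two colours
    ([weight_le_mono]), and neither does balancing ([mono_balance]). The balanced blue weighting is
    the Turan hypergraph. The red one does not beat it once any two parts leave three units of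
    weight outside ([mono_red_le_blue]), since then each edge lies in three triangles while a
    triangle has three edges. If $n < k$, every triple already lies in the Turan hypergraph. The few
    sizes where red would win, and the two exceptional values for $n = 5$, are settled by a verified
    search ([search_complete]). Lower bounds come from [turan3_free] and from [few_edges_free]. *)

(** Induction on [#|A|]. A tight proper nonempty subset is matched separately from the rest, whose
    neighbourhoods lose those of the tight set; if none is tight, Hall's condition survives matching
    one element arbitrarily. [u0] is the default value for empty [A]. *)
Theorem hall_marriage (T U : finType) (u0 : U) (r : T -> {set U}) (A : {set T}) :
  (forall X : {set T}, X \subset A -> #|X| <= #|\bigcup_(x in X) r x|) ->
  exists2 f : T -> U, {in A, forall x, f x \in r x} & {in A &, injective f}.
Proof.
have [s] := ubnP #|A|; elim: s A r => // s IHs A r leAs hallA.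
have bigcup_setDr (Y : {set T}) (N : {set U}) :
    \bigcup_(x in Y) (r x :\: N) = (\bigcup_(x in Y) r x) :\: N.
  apply/setP=> u; rewrite !inE; apply/bigcupP/andP.
    by case=> x xY /setDP[ux ->]; split=> //; apply/bigcupP; exists x.
  by case=> uN /bigcupP[x xY ux]; exists x => //; rewrite inE uN.
pose tight X := [&& X != set0, X \proper A & #|\bigcup_(x in X) r x| <= #|X|].
case: (pickP tight) => [X /and3P[X0 pXA tX]|slack].
  have sXA := proper_sub pXA; pose N := \bigcup_(x in X) r x.
  have ltXA := proper_card pXA.
  have [||f fr fI] := IHs X r; first by lia.
    by move=> Y sYX; apply: hallA; apply: subset_trans sXA.
  have [||g gr gI] := IHs (A :\: X) (fun x => r x :\: N).
  - by rewrite cardsD (setIidPr sXA); move: X0; rewrite -card_gt0; lia.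
  - move=> Y /subsetDP[sYA dYX].
    have := hallA (X :|: Y); rewrite subUset sXA sYA => /(_ isT).
    rewrite bigcup_setU bigcup_setDr -/N.
    have := cardsUI X Y; have := cardsUI N (\bigcup_(x in Y) r x).
    have := cardsID N (\bigcup_(x in Y) r x); rewrite [_ :&: N]setIC.
    have -> : X :&: Y = set0 by apply/eqP; rewrite setI_eq0 disjoint_sym.
    by rewrite cards0; move: tX; rewrite -/N; lia.
  have gN x : x \in A -> x \notin X -> g x \in r x :\: N.
    by move=> xA xX; apply: gr; rewrite inE xX.
  have fN x : x \in X -> f x \in N.
    by move=> xX; apply/bigcupP; exists x => //; apply: fr.
  exists (fun x => if x \in X then f x else g x) => [x xA|x y xA yA] /=.
    case: ifPn => xX; first exact: fr.
    by have /setDP[] := gN x xA xX.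
  case: ifPn => xX; case: ifPn => yX; first exact: fI.
  - by move=> E; have /setDP[_] := gN y yA yX; rewrite -E fN.
  - by move=> E; have /setDP[_] := gN x xA xX; rewrite E fN.
  - by move=> E; apply: gI; rewrite // inE ?xX ?yX.
have [->|[a aA]] := set_0Vmem A.
  by exists (fun=> u0) => [x|x y]; rewrite inE.
have [u ua] : exists u, u \in r a.
  apply/card_gt0P; have := hallA [set a].
  by rewrite sub1set big_set1 cards1; apply.
have [||g gr gI] := IHs (A :\ a) (fun x => r x :\ u).
- by move: leAs; rewrite (cardsD1 a A) aA.
- move=> Y sYA; have [->|Y0] := eqVneq Y set0; first by rewrite cards0.
  rewrite bigcup_setDr; have := slack Y; rewrite /tight Y0 /=.
  have -> /= : Y \proper A by apply: sub_proper_trans sYA (properD1 aA).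
  by rewrite (cardsD1 u (\bigcup_(x in Y) r x)); case: (_ \in _); lia.
exists (fun x => if x == a then u else g x) => [x xA|x y xA yA] /=.
  case: eqP => [->//|/eqP xa].
  by have /setD1P[] : g x \in r x :\ u by apply: gr; rewrite !inE xa.
have gu z : z \in A -> z != a -> g z != u.
  by move=> zA za; have /setD1P[] : g z \in r z :\ u by apply: gr; rewrite !inE za.
case: eqP => [->|/eqP xa]; case: eqP => [->|/eqP ya] //.
- by move=> E; have := gu y yA ya; rewrite -E eqxx.
- by move=> E; have := gu x xA xa; rewrite E eqxx.
- by apply: gI; rewrite !inE ?xa ?ya.
Qed.

(** Enumerating the core [C] turns representatives of its pairs into a Berge copy. Both the
    decomposition and the search produce copies in this form. *)
Lemma berge_clique_of_sdr (T : finType) (k : nat) (H : {set {set T}})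
    (C : {set T}) (g : {set T} -> {set T}) :
  #|C| = k ->
  (forall P : {set T}, P \subset C -> #|P| = 2 -> g P \in H /\ P \subset g P) ->
  (forall P Q : {set T}, P \subset C -> #|P| = 2 -> Q \subset C -> #|Q| = 2 ->
     g P = g Q -> P = Q) ->
  contains_berge (complete_graph k) H.
Proof.
move=> cardC gH gI; pose phi (i : 'I_k) := enum_val (cast_ord (esym cardC) i).
have phiI : injective phi by move=> i j /enum_val_inj /cast_ord_inj.
have sub_phi (e : {set 'I_k}) : phi @: e \subset C.
  by apply/subsetP=> _ /imsetP[i _ ->]; apply: enum_valP.
have card_phi (e : {set 'I_k}) : e \in complete_graph k -> #|phi @: e| = 2.
  by rewrite inE card_imset // => /eqP.
apply/contains_bergeP; exists phi, (fun e : {set 'I_k} => g (phi @: e)).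
split=> // [e e' /card_phi ce /card_phi ce'|e /card_phi ce|e /card_phi ce].
- by move/gI => /(_ (sub_phi _) ce (sub_phi _) ce') /(imset_inj phiI).
- by have [] := gH _ (sub_phi e) ce.
- by have [] := gH _ (sub_phi e) ce.
Qed.

(* [H1] maximizes [#|X| - #|\bigcup_(e in X) N e|]: maximality is Hall's         *)
(* condition for both matchings.                                                *)
Lemma deficiency_decomposition (E P : finType) (e0 : E) (p0 : P)
    (N : E -> {set P}) (H : {set E}) :
  exists2 H1 : {set E}, H1 \subset H &
    (exists2 g : P -> E,
       {in \bigcup_(e in H1) N e, forall p, g p \in H1 /\ p \in N (g p)} &
       {in \bigcup_(e in H1) N e &, injective g}) /\
    (exists2 f : E -> P,
       {in H :\: H1, forall e, f e \in N e :\: \bigcup_(e in H1) N e} &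
       {in H :\: H1 &, injective f}).
Proof.
pose nb (X : {set E}) := \bigcup_(e in X) N e.
(* The deficiency shifted by [#|P|], which keeps the subtraction of naturals exact. *)
pose def (X : {set E}) := #|X| + (#|P| - #|nb X|).
have [H1 sH1 maxH1] := @arg_maxnP _ set0 (fun X => X \subset H) def (sub0set _).
have {}maxH1 (X : {set E}) : X \subset H -> #|X| + #|nb H1| <= #|H1| + #|nb X|.
  move/maxH1; rewrite /def.
  by have := max_card (nb H1); have := max_card (nb X); lia.
exists H1 => //; rewrite -/(nb H1); split.
  pose cover p := [set e in H1 | p \in N e].
  have [Y sYN|g gr gI] := @hall_marriage _ _ e0 cover (nb H1).
    (* Deleting [Z] from [H1] removes all of [Y] from the neighbourhood, so a set [Z] smaller than
       [Y] would contradict maximality. *)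
    pose Z := \bigcup_(p in Y) cover p.
    have sHZ : H1 :\: Z \subset H by apply: subset_trans (subsetDl _ _) sH1.
    have sN : nb (H1 :\: Z) \subset nb H1 :\: Y.
      apply/subsetP=> p /bigcupP[e /setDP[eH1 eZ] pe]; rewrite inE.
      apply/andP; split; last by apply/bigcupP; exists e.
      by apply: contra eZ => pY; apply/bigcupP; exists p; rewrite // inE eH1.
    have := maxH1 _ sHZ; have := subset_leq_card sN.
    have := cardsID Y (nb H1); rewrite (setIidPr sYN).
    have := cardsID Z H1; have := subset_leq_card (subsetIr H1 Z).
    by rewrite -/Z; lia.
  by exists g => // p pN; have := gr p pN; rewrite inE => /andP[].
pose out e := N e :\: nb H1.
have [X /subsetDP[sXH dX]|f fr fI] := @hall_marriage _ _ p0 out (H :\: H1).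
  (* Adding [X] to [H1] brings in only the new neighbours [out], so too few of them would contradict
     maximality. *)
  have sHX : H1 :|: X \subset H by rewrite subUset sH1.
  have sN : nb (H1 :|: X) \subset nb H1 :|: \bigcup_(e in X) out e.
    apply/subsetP=> p /bigcupP[e eHX pe]; rewrite in_setU.
    case: (boolP (p \in nb H1)) => //= pH1; apply/bigcupP; exists e.
      by case/setUP: eHX => // eH1; case/negP: pH1; apply/bigcupP; exists e.
    by rewrite inE pH1.
  have := maxH1 _ sHX; have := subset_leq_card sN.
  have := cardsUI H1 X; have := cardsUI (nb H1) (\bigcup_(e in X) out e).
  have -> : H1 :&: X = set0 by apply/eqP; rewrite setI_eq0 disjoint_sym.
  by rewrite cards0; lia.
by exists f.
Qed.

Definition pairs_in (T : finType) (e : {set T}) : {set {set T}} :=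
  [set P : {set T} | P \subset e & #|P| == 2].

Definition shadow (T : finType) (H : {set {set T}}) : {set {set T}} :=
  \bigcup_(e in H) pairs_in e.

(** In a fully coloured [C], blue pairs would be represented through [g] inside [H1] and red pairs
    by the hyperedges outside [H1] that [f] sends to them; the two kinds cannot collide, so a Berge
    copy would arise. *)
Lemma red_blue_decomposition (T : finType) (k : nat) (H : {set {set T}}) :
  ~~ contains_berge (complete_graph k) H ->
  exists (H1 R : {set {set T}}),
    [/\ H1 \subset H, forall P, P \in R -> #|P| = 2 /\ P \notin shadow H1,
        #|H| = #|H1| + #|R|
      & forall C : {set T}, #|C| = k ->
          exists P : {set T}, [/\ P \subset C, #|P| = 2 & P \notin shadow H1 :|: R]].
Proof.
move=> freeH.
have [H1 sH1 [[g gr gI] [f fr fI]]] :=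
  deficiency_decomposition set0 set0 (@pairs_in T) H.
rewrite -/(shadow H1) in gr gI fr.
have fP e : e \in H :\: H1 -> [/\ f e \subset e, #|f e| = 2 & f e \notin shadow H1].
  by move/fr; rewrite !inE => /and3P[-> -> /eqP].
have gP (P : {set T}) : P \in shadow H1 -> g P \in H1 /\ P \subset g P.
  by move/gr=> [->]; rewrite inE => /andP[].
pose R : {set {set T}} := f @: (H :\: H1); exists H1, R; split=> // [P /imsetP[e eH ->]||C cC].
- by have [] := fP e eH.
- have := cardsID H1 H; rewrite (setIidPr sH1) => <-.
  by rewrite card_in_imset.
pose good (P : {set T}) := [&& P \subset C, #|P| == 2 & P \notin shadow H1 :|: R].
case: (pickP good) => [P /and3P[sPC /eqP cP PN]|bad]; first by exists P.
pose pre (P : {set T}) := odflt set0 [pick e in H :\: H1 | f e == P].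
have preP (P : {set T}) : P \subset C -> #|P| = 2 -> P \notin shadow H1 ->
    pre P \in H :\: H1 /\ f (pre P) = P.
  move=> sPC cP PN; have := bad P; rewrite /good sPC cP eqxx in_setU (negPf PN) /=.
  move/negbFE/imsetP=> [e eH Pe]; rewrite /pre.
  case: pickP => /= [e' /andP[-> /eqP]//|].
  by move/(_ e); rewrite eH Pe eqxx.
pose G P := if P \in shadow H1 then g P else pre P.
case/negP: freeH; apply: (@berge_clique_of_sdr _ _ _ C G) => // [P sPC cP|].
  rewrite /G; case: ifPn => PN.
    by have [/(subsetP sH1)] := gP P PN.
  have [eH fe] := preP P sPC cP PN; split; first by case/setDP: eH.
  by have [] := fP _ eH; rewrite fe.
move=> P Q sPC cP sQC cQ; rewrite /G; case: ifPn => PN; case: ifPn => QN.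
- exact: gI.
- move=> E; have [/setDP[_ /negP[]]] := preP Q sQC cQ QN.
  by rewrite -E; have [] := gP P PN.
- move=> E; have [/setDP[_ /negP[]]] := preP P sPC cP PN.
  by rewrite E; have [] := gP Q QN.
- move=> E; have [_ <-] := preP P sPC cP PN; have [_ <-] := preP Q sQC cQ QN.
  by rewrite E.
Qed.

(** * Weighted red-blue graphs *)

(** Integration of [f] against the measure [x]; nesting it sums over tuples of vertices of a
    blow-up. *)
Definition ev (T : finType) (x f : T -> nat) : nat := \sum_u x u * f u.

Lemma eq_ev (T : finType) (x f g : T -> nat) : f =1 g -> ev x f = ev x g.
Proof. by move=> fg; apply: eq_bigr => u _; rewrite fg. Qed.

Lemma evD (T : finType) (x f g : T -> nat) :
  ev x (fun u => f u + g u) = ev x f + ev x g.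
Proof. by rewrite -big_split; apply: eq_bigr => u _; rewrite mulnDr. Qed.

Lemma evZ (T : finType) (x f : T -> nat) (c : nat) :
  ev x (fun u => c * f u) = c * ev x f.
Proof. by rewrite big_distrr; apply: eq_bigr => u _; rewrite mulnCA. Qed.

(** [y] is [x] with the weights at [a] and [c] erased, and supplies the coefficients of expansions
    in [x a] and [x c]. *)
Definition agree_off2 (T : finType) (a c : T) (x y : T -> nat) : Prop :=
  [/\ forall u, u != a -> u != c -> x u = y u, y a = 0 & y c = 0].

Lemma ev_off2 (T : finType) (a c : T) (x y f : T -> nat) :
  a != c -> agree_off2 a c x y -> ev x f = ev y f + x a * f a + x c * f c.
Proof.
move=> nac [xy ya yc]; rewrite /ev.
have split2 (z : T -> nat) : \sum_u z u * f u =
    z a * f a + (z c * f c + \sum_(u | (u != a) && (u != c)) z u * f u).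
  by rewrite (bigD1 a) //= (bigD1 c) //= eq_sym.
rewrite !split2 ya yc; set S := \sum_(u | _) y u * f u.
have -> : \sum_(u | (u != a) && (u != c)) x u * f u = S.
  by apply: eq_bigr => u /andP[ua uc]; rewrite xy.
by lia.
Qed.

Definition triangle (T : finType) (b : rel T) (u v w : T) : bool :=
  [&& b u v, b v w & b u w].

(* Six times the number of red edges plus blue triangles in the blow-up that     *)
(* replaces vertex [u] by [x u] copies: the sums run over ordered tuples.        *)
Definition weight (T : finType) (r b : rel T) (x : T -> nat) : nat :=
  3 * ev x (fun u => ev x (fun v => r u v)) +
  ev x (fun u => ev x (fun v => ev x (fun w => triangle b u v w))).

(* [weight] is affine in each [x a], with slope [degree]. *)
Definition degree (T : finType) (r b : rel T) (y : T -> nat) (a : T) : nat :=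
  6 * ev y (fun v => r a v) + 3 * ev y (fun v => ev y (fun w => triangle b a v w)).

Lemma eq_weight (T : finType) (r b : rel T) (x y : T -> nat) :
  x =1 y -> weight r b x = weight r b y.
Proof.
move=> xy; have E f : ev x f = ev y f by apply: eq_bigr => u _; rewrite xy.
rewrite /weight !E; congr (3 * _ + _); apply: eq_ev => u; rewrite E //.
by apply: eq_ev => v; rewrite E.
Qed.

(** Without loops there are no terms in the squares of [x a] and [x c]. The mixed coefficient counts
    the red edge between [a] and [c] and the blue triangles through both, in all their orderings. *)
Lemma weight_off2 (T : finType) (r b : rel T) (a c : T) (x y : T -> nat) :
  symmetric r -> irreflexive r -> symmetric b -> irreflexive b ->
  a != c -> agree_off2 a c x y ->
  weight r b x = weight r b y + x a * degree r b y a + x c * degree r b y c +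
    6 * (x a * x c) * (r a c + ev y (fun w => triangle b a c w)).
Proof.
move=> rC rI bC bI nac xy; have E f := ev_off2 f nac xy.
have EE (g : T -> T -> nat) : ev x (fun u => ev x (g u)) =
    ev x (fun u => ev y (g u) + x a * g u a + x c * g u c).
  by apply: eq_ev => u; rewrite E.
have tC u v w : triangle b u v w = triangle b v u w.
  by rewrite /triangle bC andbA andbAC -andbA.
have tC' u v w : triangle b u v w = triangle b u w v.
  by rewrite /triangle [b w v]bC; case: (b u v); case: (b u w); case: (b v w).
have taa u v : triangle b u u v = false by rewrite /triangle bI.
have red : ev x (fun u => ev x (fun v => r u v)) =
    ev y (fun u => ev y (fun v => r u v)) + 2 * x a * ev y (fun v => r a v) +
    2 * x c * ev y (fun v => r c v) + 2 * x a * x c * r a c.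
  have sym u : ev y (fun v => r v u) = ev y (fun v => r u v).
    by apply: eq_ev => v; rewrite rC.
  rewrite EE E !evD !evZ !sym.
  by rewrite !rI [r c a]rC /=; ring.
have blue2 u : ev x (fun v => ev x (fun w => triangle b u v w)) =
    ev y (fun v => ev y (fun w => triangle b u v w)) +
    2 * x a * ev y (fun w => triangle b u a w) +
    2 * x c * ev y (fun w => triangle b u c w) + 2 * x a * x c * triangle b u a c.
  have sym z : ev y (fun v => triangle b u v z) = ev y (fun v => triangle b u z v).
    by apply: eq_ev => v; rewrite tC'.
  rewrite EE E !evD !evZ !sym.
  have -> : triangle b u a a = false by rewrite /triangle bI andbF.
  have -> : triangle b u c c = false by rewrite /triangle bI andbF.
  by rewrite [triangle b u c a]tC' /=; ring.
have sym2 v : ev y (fun u => ev y (fun w => triangle b u v w)) =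
    ev y (fun u => ev y (fun w => triangle b v u w)).
  by apply: eq_ev => u; apply: eq_ev => w; rewrite tC.
have sym1 u v : ev y (fun w => triangle b u v w) = ev y (fun w => triangle b v u w).
  by apply: eq_ev => w; rewrite tC.
have zero u : ev y (fun w => triangle b u u w) = 0.
  by rewrite /ev big1 // => w _; rewrite taa muln0.
have symac : ev y (fun u => triangle b u a c) = ev y (fun w => triangle b a c w).
  by apply: eq_ev => u; rewrite tC tC'.
have blue3 : ev x (fun u => ev x (fun v => ev x (fun w => triangle b u v w))) =
    ev x (fun u => ev y (fun v => ev y (fun w => triangle b u v w)) +
    2 * x a * ev y (fun w => triangle b u a w) +
    2 * x c * ev y (fun w => triangle b u c w) + 2 * x a * x c * triangle b u a c).
  exact: eq_ev.
rewrite /weight red blue3 E !evD !evZ !sym2 symac !zero !taa.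
have -> : triangle b c a c = false by rewrite /triangle bI !andbF.
by rewrite [ev y (fun w => triangle b c a w)]sym1 /degree /=; ring.
Qed.

Definition mass (T : finType) (x : T -> nat) : nat := \sum_u x u.

Definition supp (T : finType) (x : T -> nat) : {set T} := [set u | x u != 0].

(* The weight when all pairs are red ([blue = false]) or all are blue. *)
Definition mono (T : finType) (blue : bool) (x : T -> nat) : nat :=
  weight (fun u v => ~~ blue && (u != v)) (fun u v => blue && (u != v)) x.

Definition merge2 (T : finType) (a c : T) (x : T -> nat) (u : T) : nat :=
  if u == a then x a + x c else if u == c then 0 else x u.

Definition off2 (T : finType) (a c : T) (x : T -> nat) (u : T) : nat :=
  if (u == a) || (u == c) then 0 else x u.

Lemma off2P (T : finType) (a c : T) (x : T -> nat) : agree_off2 a c x (off2 a c x).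
Proof.
by rewrite /off2; split=> [u /negPf-> /negPf->|//|]; rewrite ?eqxx ?orbT.
Qed.

Lemma merge2P (T : finType) (a c : T) (x : T -> nat) :
  agree_off2 a c (merge2 a c x) (off2 a c x).
Proof.
have [xy ya yc] := off2P a c x; split=> // u ua uc.
by rewrite -xy // /merge2 (negPf ua) (negPf uc).
Qed.

Lemma mass_off2 (T : finType) (a c : T) (x y : T -> nat) :
  a != c -> agree_off2 a c x y -> mass x = mass y + x a + x c.
Proof.
have mE z : ev z (fun=> 1) = mass z by apply: eq_bigr => u _; rewrite muln1.
by move=> nac /(ev_off2 (fun=> 1) nac); rewrite !mE !muln1.
Qed.

Lemma mass_merge2 (T : finType) (a c : T) (x : T -> nat) :
  a != c -> mass (merge2 a c x) = mass x.
Proof.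
move=> nac; rewrite (mass_off2 nac (merge2P a c x)) (mass_off2 nac (off2P a c x)).
by rewrite /merge2 eqxx [c == a]eq_sym (negPf nac) eqxx; lia.
Qed.

Lemma supp_merge2 (T : finType) (a c : T) (x : T -> nat) :
  a != c -> a \in supp x -> c \in supp x -> supp (merge2 a c x) \proper supp x.
Proof.
move=> nac; rewrite !inE => xa xc; apply/properP; split.
  apply/subsetP=> u; rewrite !inE /merge2; case: (eqVneq u a) => [->//|_].
  by case: ifP.
by exists c; rewrite !inE // /merge2 [c == a]eq_sym (negPf nac) eqxx.
Qed.

(** No blue triangle contains both [a] and [c], so up to the red term the weight is linear in [x a]
    and [x c]: moving everything to the endpoint of larger degree loses at most that term. *)
Lemma weight_merge2 (T : finType) (r b : rel T) (a c : T) (x : T -> nat) :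
  symmetric r -> irreflexive r -> symmetric b -> irreflexive b ->
  a != c -> ~~ b a c ->
  weight r b x <= weight r b (merge2 a c x) + 6 * (x a * x c) * r a c \/
  weight r b x <= weight r b (merge2 c a x) + 6 * (x a * x c) * r a c.
Proof.
move=> rC rI bC bI nac nbac; have nca : c != a by rewrite eq_sym.
have codeg0 y : ev y (fun w => triangle b a c w) = 0.
  by rewrite /ev big1 // => w _; rewrite /triangle (negPf nbac) muln0.
have codeg0' y : ev y (fun w => triangle b c a w) = 0.
  by rewrite /ev big1 // => w _; rewrite /triangle bC (negPf nbac) muln0.
have off2C : weight r b (off2 c a x) = weight r b (off2 a c x) /\
    degree r b (off2 c a x) =1 degree r b (off2 a c x).
  have E : off2 c a x =1 off2 a c x by move=> u; rewrite /off2 orbC.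
  have E' f : ev (off2 c a x) f = ev (off2 a c x) f.
    by apply: eq_bigr => u _; rewrite E.
  split=> [|u]; first exact: eq_weight.
  by rewrite /degree !E'; congr (_ + 3 * _); apply: eq_ev => v; rewrite E'.
rewrite (weight_off2 rC rI bC bI nac (off2P a c x)) codeg0.
rewrite (weight_off2 rC rI bC bI nac (merge2P a c x)) codeg0.
rewrite (weight_off2 rC rI bC bI nca (merge2P c a x)) codeg0'.
rewrite off2C.1 !off2C.2 /merge2 !eqxx (negPf nac) (negPf nca).
move: (degree _ _ _ a) (degree _ _ _ c) (weight _ _ _) => da dc W.
by have [le|le] := leqP da dc; [right|left]; nia.
Qed.

(** All vertices outside the support of [y] have the same degree here, so only the sum and the
    product of [x a] and [x c] matter. *)
Lemma mono_off2 (T : finType) (blue : bool) (a c : T) (x y : T -> nat) :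
  a != c -> agree_off2 a c x y ->
  mono blue x = mono blue y +
    (x a + x c) * (6 * (~~ blue * mass y) +
                   3 * (blue * ev y (fun v => ev y (fun w => v != w)))) +
    6 * (x a * x c) * (if blue then mass y else 1).
Proof.
move=> nac xy; have [_ ya yc] := xy.
have Cne (p : bool) : symmetric (fun u v : T => p && (u != v)).
  by move=> u v; rewrite eq_sym.
have Ine (p : bool) : irreflexive (fun u v : T => p && (u != v)).
  by move=> u; rewrite eqxx andbF.
have deg d : y d = 0 ->
    degree (fun u v => ~~ blue && (u != v)) (fun u v => blue && (u != v)) y d =
    6 * (~~ blue * mass y) + 3 * (blue * ev y (fun v => ev y (fun w => v != w))).
  move=> yd; congr (6 * _ + 3 * _).
    rewrite /mass big_distrr; apply: eq_bigr => v _ /=.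
    by case: (eqVneq d v) => [<-|_]; rewrite ?yd ?muln0 // andbT mulnC.
  rewrite -evZ; apply: eq_bigr => v _.
  case: (eqVneq d v) => [<-|dv]; first by rewrite yd !mul0n.
  congr (_ * _); rewrite -evZ; apply: eq_bigr => w _.
  case: (eqVneq d w) => [<-|dw]; first by rewrite yd !mul0n.
  by rewrite /triangle (negPf dv) (negPf dw) /= !andbT; case: blue; case: eqP.
rewrite /mono (weight_off2 _ _ _ _ nac xy) //; try exact: Cne; try exact: Ine.
rewrite !deg // nac andbT mulnDl addnA; congr (_ + _ * _); rewrite /mass.
case: blue {deg} => /=; last by rewrite /ev big1 // => w _; rewrite /= muln0.
apply: eq_bigr => w _; rewrite /triangle nac /=.
case: (eqVneq c w) => [<-|_]; first by rewrite yc.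
by case: (eqVneq a w) => [<-|_]; rewrite ?ya ?muln1.
Qed.

Lemma mono_merge2 (T : finType) (blue : bool) (a c : T) (x : T -> nat) :
  a != c ->
  mono blue x = mono blue (merge2 a c x) +
    6 * (x a * x c) * (if blue then mass (off2 a c x) else 1).
Proof.
move=> nac; rewrite (mono_off2 blue nac (off2P a c x)).
rewrite (mono_off2 blue nac (merge2P a c x)) /merge2 eqxx [c == a]eq_sym (negPf nac) eqxx.
by move: (_ + 3 * _) (if blue then _ else _) => D K; lia.
Qed.

(* Merging a red pair [a], [c] costs [x a * x c], which a monochromatic blow-up  *)
(* pays for as soon as some third vertex is present.                             *)
Lemma weight_le_mono (T : finType) (r b : rel T) (x : T -> nat) :
  symmetric r -> irreflexive r -> symmetric b -> irreflexive b ->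
  (forall u v, b u v -> ~~ r u v) ->
  weight r b x <= mono false x \/ weight r b x <= mono true x.
Proof.
move=> rC rI bC bI dis.
have [s] := ubnP #|supp x|; elim: s x => // s IHs x le_s.
case: (pickP (fun p : T * T =>
  [&& p.1 != p.2, p.1 \in supp x, p.2 \in supp x & ~~ b p.1 p.2])) => /= [[a c]|all_b].
  case/and4P=> /= nac xa xc nbac; have nca : c != a by rewrite eq_sym.
  wlog le : a c nac nca xa xc nbac /
      weight r b x <= weight r b (merge2 a c x) + 6 * (x a * x c) * r a c.
    move=> W; have [|] := weight_merge2 x rC rI bC bI nac nbac; first exact: W.
    by rewrite [x a * _]mulnC rC; apply: W => //; rewrite bC.
  have := proper_card (supp_merge2 nac xa xc) => lt_supp.
  have [||] := IHs (merge2 a c x) _; first by lia.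
    move=> le'; left; rewrite (mono_merge2 false x nac).
    by case: (r a c) le => /=; lia.
  (* Without a third vertex blue cannot pay for the lost red pair, but then that pair is the whole
     weight and the red bound holds directly. *)
  move=> le'; case: (posnP (mass (off2 a c x))) => [m0|m_gt0]; last first.
    right; rewrite (mono_merge2 true x nac).
    by case: (r a c) le => /=; nia.
  have y0 u : off2 a c x u = 0 by apply/eqP; move/eqP: m0; rewrite sum_nat_eq0 => /forallP/(_ u).
  have ev0 f : ev (off2 a c x) f = 0 by rewrite /ev big1 // => u _; rewrite y0.
  left; rewrite (weight_off2 rC rI bC bI nac (off2P a c x)).
  rewrite (mono_off2 false nac (off2P a c x)) /weight /degree !ev0.
  by case: (r a c); lia.
(* All pairs in the support are blue here, so the red part vanishes. *)
right; apply: leq_add; last first.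
  apply: leq_sum => u _; rewrite leq_mul2l; apply/orP; right.
  apply: leq_sum => v _; rewrite leq_mul2l; apply/orP; right.
  apply: leq_sum => w _; rewrite leq_mul2l; apply/orP; right.
  have ne i j : b i j -> i != j by apply: contraTneq => ->; rewrite bI.
  rewrite /triangle; case: (boolP (b u v)) => //= /ne->.
  by case: (boolP (b v w)) => //= /ne->; case: (boolP (b u w)) => //= /ne->.
rewrite {1}/ev big1 ?muln0 // => u _.
case: (posnP (x u)) => [->//|xu]; rewrite /ev big1 ?muln0 // => v _.
case: (posnP (x v)) => [->//|xv].
case: (eqVneq u v) => [->|uv]; first by rewrite rI muln0.
have := all_b (u, v); rewrite /= uv !inE.
by rewrite -!lt0n xu xv /= => /negbFE/dis/negPf->; rewrite muln0.
Qed.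

(** Zykov symmetrization: merging two nonadjacent vertices of the support in the better direction
    costs nothing and shrinks the support. *)
Lemma weight_le_clique (T : finType) (r b : rel T) (x : T -> nat) :
  symmetric r -> irreflexive r -> symmetric b -> irreflexive b ->
  exists z : T -> nat, [/\ mass z = mass x, weight r b x <= weight r b z
    & {in supp z &, forall u v, u != v -> r u v || b u v}].
Proof.
move=> rC rI bC bI.
have [s] := ubnP #|supp x|; elim: s x => // s IHs x le_s.
case: (pickP (fun p : T * T => [&& p.1 != p.2, p.1 \in supp x, p.2 \in supp x &
    ~~ (r p.1 p.2 || b p.1 p.2)])) => /= [[a c]|clique]; last first.
  exists x; split=> // u v xu xv uv; have := clique (u, v).
  by rewrite /= uv xu xv => /negbFE.
case/and4P=> /= nac xa xc /norP[nrac nbac]; have nca : c != a by rewrite eq_sym.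
wlog le : a c nac nca xa xc nrac nbac / weight r b x <= weight r b (merge2 a c x).
  move=> W; have := weight_merge2 x rC rI bC bI nac nbac.
  by rewrite (negPf nrac) !muln0 !addn0 => -[|]; apply: W; rewrite // ?[r c a]rC ?[b c a]bC.
have := proper_card (supp_merge2 nac xa xc) => lt_supp.
have [|z [mz wz cz]] := IHs (merge2 a c x); first by lia.
by exists z; split=> //; [rewrite mz mass_merge2 | apply: leq_trans wz].
Qed.

(** * Balancing monochromatic weightings *)

Definition shift1 (T : finType) (a c : T) (x : T -> nat) (u : T) : nat :=
  if u == a then (x a).-1 else if u == c then (x c).+1 else x u.

Lemma shift1P (T : finType) (a c : T) (x : T -> nat) :
  agree_off2 a c (shift1 a c x) (off2 a c x).
Proof.
have [xy ya yc] := off2P a c x; split=> // u ua uc.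
by rewrite -xy // /shift1 (negPf ua) (negPf uc).
Qed.

(** Moving one unit from [a] to [c] when [x a] exceeds [x c] by at least two keeps their sum and
    increases their product; the sum of squares [ev x x] drops, which ends the process. *)
Lemma mono_balance (T : finType) (blue : bool) (U : {set T}) (x : T -> nat) :
  supp x \subset U ->
  exists z : T -> nat, [/\ supp z \subset U, mass z = mass x,
    mono blue x <= mono blue z & {in U &, forall u v, z u <= (z v).+1}].
Proof.
have [s] := ubnP (ev x x); elim: s x => // s IHs x le_s sxU.
case: (pickP (fun p : T * T => [&& p.1 \in U, p.2 \in U & (x p.2).+1 < x p.1]))
    => /= [[a c]|bal]; last first.
  exists x; split=> // u v uU vU; have := bal (u, v).
  by rewrite /= uU vU /= => /negbT; rewrite -leqNgt.
case/and3P=> /= aU cU lt_ca.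
have nac : a != c by apply: contraTneq lt_ca => ->; lia.
have sa : shift1 a c x a = (x a).-1 by rewrite /shift1 eqxx.
have sc : shift1 a c x c = (x c).+1.
  by rewrite /shift1 [c == a]eq_sym (negPf nac) eqxx.
have [||z [szU mz le_z balz]] := IHs (shift1 a c x).
- suff : ev (shift1 a c x) (shift1 a c x) < ev x x by lia.
  rewrite (ev_off2 _ nac (shift1P a c x)) (ev_off2 x nac (off2P a c x)) sa sc.
  have -> : ev (off2 a c x) (shift1 a c x) = ev (off2 a c x) x.
    apply: eq_bigr => u _; rewrite /off2 /shift1.
    by case: eqP; case: eqP; rewrite ?mul0n.
  by nia.
- apply/subsetP=> u; rewrite inE /shift1.
  case: (eqVneq u a) => [->//|_]; case: (eqVneq u c) => [->//|_] xu.
  by apply: (subsetP sxU); rewrite inE.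
exists z; split=> //.
  rewrite mz (mass_off2 nac (shift1P a c x)) (mass_off2 nac (off2P a c x)) sa sc.
  by lia.
apply: leq_trans le_z; rewrite (mono_off2 blue nac (shift1P a c x)).
rewrite (mono_off2 blue nac (off2P a c x)) sa sc.
move: (_ + 3 * _) (if blue then _ else _) => D K.
have -> : (x a).-1 + (x c).+1 = x a + x c by lia.
by rewrite leq_add2l leq_mul2r leq_mul2l; apply/orP; right; nia.
Qed.

Lemma ev_const (T : finType) (x : T -> nat) (c : nat) : ev x (fun=> c) = mass x * c.
Proof. by rewrite /mass big_distrl. Qed.

Lemma ev_eq (T : finType) (x f : T -> nat) (v : T) :
  ev x (fun u => (v == u) * f u) = x v * f v.
Proof.
rewrite /ev (bigD1 v) //= eqxx mul1n big1 ?addn0 // => u.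
by rewrite eq_sym => /negPf->; rewrite mul0n muln0.
Qed.

(* Inclusion-exclusion over the coincidences among three indices. *)
Lemma mono_blueE (T : finType) (x : T -> nat) :
  mono true x + 3 * mass x * ev x x = mass x ^ 3 + 2 * ev x (fun u => x u * x u).
Proof.
have ev1 v : ev x (fun u => v == u) = x v.
  have := ev_eq x (fun=> 1) v; rewrite muln1 => <-.
  by apply: eq_ev => u; rewrite muln1.
have ev3 : ev x (fun u => ev x (fun v => ev x (fun w =>
    triangle (fun u v => u != v) u v w + ((u == v) * 1 + ((v == w) + (u == w)))))) =
  ev x (fun u => ev x (fun v => ev x (fun w => 1 + 2 * ((u == v) * (v == w))))).
  apply: eq_ev => u; apply: eq_ev => v; apply: eq_ev => w; rewrite /triangle.
  case: (eqVneq u v) => [<-|uv]; first by case: (u == w).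
  case: (eqVneq v w) => [<-|_]; first by rewrite (negPf uv).
  by case: (u == w).
have lhs : ev x (fun u => ev x (fun v => ev x (fun w =>
    triangle (fun u v => u != v) u v w + ((u == v) * 1 + ((v == w) + (u == w)))))) =
    mono true x + 3 * mass x * ev x x.
  have -> : mono true x = ev x (fun u => ev x (fun v => ev x (fun w =>
      triangle (fun u v => u != v) u v w))).
    by rewrite /mono /weight [X in 3 * X]big1 // => u _; rewrite ev_const !muln0.
  have E u v : ev x (fun w =>
      triangle (fun u v => u != v) u v w + ((u == v) * 1 + ((v == w) + (u == w)))) =
      ev x (fun w => triangle (fun u v => u != v) u v w) +
      ((u == v) * mass x + (x v + x u)).
    by rewrite !evD !ev1 ev_const muln1 [mass x * _]mulnC.
  have {}E u : ev x (fun v => ev x (fun w =>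
      triangle (fun u v => u != v) u v w + ((u == v) * 1 + ((v == w) + (u == w))))) =
      ev x (fun v => ev x (fun w => triangle (fun u v => u != v) u v w)) +
      (mass x * x u + (ev x x + mass x * x u)).
    rewrite (eq_ev _ (E u)) !evD (ev_eq x (fun=> mass x)) ev_const.
    by rewrite [x u * _]mulnC.
  by rewrite (eq_ev _ E) !evD !evZ ev_const; ring.
have rhs : ev x (fun u => ev x (fun v => ev x (fun w =>
    1 + 2 * ((u == v) * (v == w))))) = mass x ^ 3 + 2 * ev x (fun u => x u * x u).
  have E u v : ev x (fun w => 1 + 2 * ((u == v) * (v == w))) =
      mass x + 2 * ((u == v) * x v).
    by rewrite evD !evZ ev1 ev_const muln1.
  have {}E u : ev x (fun v => ev x (fun w => 1 + 2 * ((u == v) * (v == w)))) =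
      mass x * mass x + 2 * (x u * x u).
    by rewrite (eq_ev _ (E u)) evD evZ ev_const ev_eq.
  by rewrite (eq_ev _ E) evD !evZ ev_const !expnS expn0 muln1.
by rewrite -lhs ev3 rhs.
Qed.

(** The hypothesis puts each edge of the blow-up in at least three triangles, and a triangle has
    only three edges. *)
Lemma mono_red_le_blue (T : finType) (x : T -> nat) :
  (forall u v, u != v -> x u != 0 -> x v != 0 ->  3 + x u + x v <= mass x) ->
  mono false x <= mono true x.
Proof.
move=> rest; rewrite /mono /weight.
rewrite [X in _ + X <= _]big1 ?addn0 => [|u _]; last first.
  rewrite /ev big1 ?muln0 // => v _; rewrite big1 ?muln0 // => w _.
  by rewrite /triangle muln0.
rewrite -evZ; apply: leq_trans (leq_addl _ _); apply: leq_sum => u _.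
have [->//|xu] := eqVneq (x u) 0; rewrite leq_mul2l; apply/orP; right.
rewrite -evZ; apply: leq_sum => v _.
have [->//|xv] := eqVneq (x v) 0; rewrite leq_mul2l; apply/orP; right.
have [->|uv] := eqVneq u v; first by rewrite muln0.
rewrite (ev_off2 _ uv (off2P u v x)) /triangle /= uv.
have := rest u v uv xu xv; rewrite (mass_off2 uv (off2P u v x)).
have -> : ev (off2 u v x) (fun w => [&& true, v != w & u != w]) = mass (off2 u v x).
  apply: eq_bigr => w _; rewrite /off2 [w == u]eq_sym [w == v]eq_sym.
  by case: (u == w); case: (v == w); rewrite //= muln1.
by lia.
Qed.

(** * Comparison with the Turan hypergraph *)

Lemma balanced_parts (I : finType) (U : {set I}) (z : I -> nat) :
  0 < #|U| -> {in U &, forall u v, z u <= (z v).+1} ->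
  let q := (\sum_(u in U) z u) %/ #|U| in
  let c := (\sum_(u in U) z u) %% #|U| in
  {in U, forall u, q <= z u <= q.+1} /\ #|[set u in U | z u != q]| = c.
Proof.
move=> U_gt0 bal; have /card_gt0P[i0 i0U] := U_gt0.
have [u0 u0U min_u0] := @arg_minnP _ i0 (mem U) z i0U.
have {}u0U : u0 \in U by [].
pose A := [set u in U | z u != z u0].
have zE u : u \in U -> z u = z u0 + (u \in A).
  move=> uU; rewrite inE uU /=; have := min_u0 u uU; have := bal u u0 uU u0U.
  by case: eqP => /=; lia.
have ltA : #|A| < #|U|.
  rewrite proper_card //; apply/properP; split; last first.
    by exists u0; rewrite // inE u0U eqxx.
  by apply/subsetP=> u; rewrite inE => /andP[].
have -> : \sum_(u in U) z u = z u0 * #|U| + #|A|.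
  rewrite (eq_bigr _ zE) big_split sum_nat_const mulnC -big_mkcondr sum1dep_card.
  by congr (_ + _); apply: eq_card => u; rewrite !inE andbA andbb.
rewrite divnMDl // modnMDl divn_small // modn_small // addn0; split=> // u uU.
by rewrite (zE u uU); case: (u \in A); rewrite ?addn0 ?addn1 ?leqnn ?leqnSn.
Qed.

(** The values of a balanced weighting and their multiplicities are forced by the total, hence so is
    every symmetric sum. *)
Lemma sum_balanced (I : finType) (U : {set I}) (z : I -> nat) (f : nat -> nat) :
  0 < #|U| -> {in U &, forall u v, z u <= (z v).+1} ->
  let q := (\sum_(u in U) z u) %/ #|U| in
  let c := (\sum_(u in U) z u) %% #|U| in
  \sum_(u in U) f (z u) = (#|U| - c) * f q + c * f q.+1.
Proof.
move=> U_gt0 bal q c; have [qz cardc] := balanced_parts U_gt0 bal.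
rewrite -/q -/c in qz cardc; rewrite (bigID (fun u => z u == q)) /=.
rewrite (eq_bigr (fun=> f q)) => [|u /andP[_ /eqP->]//].
rewrite [X in _ + X](eq_bigr (fun=> f q.+1)) => [|u /andP[uU uq]]; last first.
  by congr f; have := qz u uU; move: uq; lia.
have cardsE (p : pred I) : #|[pred u | (u \in U) && p u]| = #|[set u in U | p u]|.
  by apply: eq_card => u; rewrite !inE.
rewrite !sum_nat_const !cardsE cardc; congr (_ * _ + _).
have := cardsID [set u | z u != q] U; rewrite -cardc.
have -> : U :&: [set u | z u != q] = [set u in U | z u != q].
  by apply/setP=> u; rewrite !inE.
have -> : U :\: [set u | z u != q] = [set u in U | z u == q].
  by apply/setP=> u; rewrite !inE negbK andbC.
by lia.
Qed.

(** * Counting sets by ordered tuples *)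

(** The size bound forbids [u \in B]; this peels one coordinate off an ordered enumeration of
    [e]. *)
Lemma eq_setU1 (T : finType) (u : T) (B e : {set T}) :
  #|B| < #|e| -> (u |: B == e) = (u \in e) && (B == e :\ u).
Proof.
move=> ltBe; apply/eqP/andP => [ueB|[ue /eqP->]]; last exact: setD1K.
rewrite -ueB setU11; split=> //; case: (boolP (u \in B)) => uB.
  by move: ltBe; rewrite -ueB cardsU1 uB add0n ltnn.
by rewrite setU1K.
Qed.

Lemma sum_mem (I : finType) (G : {set I}) (x : I) :
  ((x \in G) : nat) = \sum_(e in G) (x == e).
Proof.
case: (boolP (x \in G)) => xG.
  by rewrite (bigD1 x) //= eqxx big1 // => e /andP[_]; rewrite eq_sym => /negPf->.
by rewrite big1 // => e eG; case: eqP => // xe; rewrite -xe (negPf xG) in eG.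
Qed.

Lemma sum_pairs_eq (T : finType) (e : {set T}) : #|e| = 2 ->
  \sum_u \sum_v (([set u; v] == e) : nat) = 2.
Proof.
move=> e2; rewrite -[RHS]e2 -sum1_card [RHS]big_mkcond; apply: eq_bigr => u _.
have E v : ([set u; v] == e) = (u \in e) && ([set v] == e :\ u).
  by rewrite eq_setU1 // cards1 e2.
under eq_bigr do rewrite E; case: ifP => ue; last by rewrite big1.
have /cards1P[v ->] : #|e :\ u| == 1 by move: e2; rewrite (cardsD1 u) ue; lia.
rewrite (bigD1 v) //= eqxx big1 // => w.
by rewrite (inj_eq set1_inj) => /negPf->.
Qed.

Lemma sum_triples_eq (T : finType) (e : {set T}) : #|e| = 3 ->
  \sum_u \sum_v \sum_w (([set u; v; w] == e) : nat) = 6.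
Proof.
move=> e3; have -> : 6 = \sum_(u in e) 2 by rewrite sum_nat_const e3.
rewrite [RHS]big_mkcond; apply: eq_bigr => u _.
have E v w : ([set u; v; w] == e) = (u \in e) && ([set v; w] == e :\ u).
  by rewrite -setUA eq_setU1 // cards2 e3; case: (_ != _).
under eq_bigr do under eq_bigr do rewrite E; case: ifP => ue; last first.
  by rewrite big1 // => v _; rewrite big1.
by rewrite sum_pairs_eq //; move: e3; rewrite (cardsD1 u) ue; lia.
Qed.

Lemma sum_pairs (T : finType) (G : {set {set T}}) : (forall e : {set T}, e \in G -> #|e| = 2) ->
  \sum_u \sum_v (([set u; v] \in G) : nat) = 2 * #|G|.
Proof.
move=> G2; under eq_bigr do under eq_bigr do rewrite sum_mem.
under eq_bigr do rewrite exchange_big /=.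
rewrite exchange_big /= mulnC -sum_nat_const.
by apply: eq_bigr => e /G2; apply: sum_pairs_eq.
Qed.

Lemma sum_triples (T : finType) (G : {set {set T}}) : (forall e : {set T}, e \in G -> #|e| = 3) ->
  \sum_u \sum_v \sum_w (([set u; v; w] \in G) : nat) = 6 * #|G|.
Proof.
move=> G3; under eq_bigr do under eq_bigr do under eq_bigr do rewrite sum_mem.
under eq_bigr do under eq_bigr do rewrite exchange_big /=.
under eq_bigr do rewrite exchange_big /=.
rewrite exchange_big /= mulnC -sum_nat_const.
by apply: eq_bigr => e /G3; apply: sum_triples_eq.
Qed.


Lemma exists_subset_card (T : finType) (A : {set T}) (k : nat) :
  k <= #|A| -> exists2 C : {set T}, C \subset A & #|C| = k.
Proof.
move=> lekA; exists [set x in take k (enum A)].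
  by apply/subsetP=> x; rewrite inE => /mem_take; rewrite mem_enum.
by rewrite cardsE (card_uniqP _) ?take_uniq ?enum_uniq // size_takel // -cardE.
Qed.

Lemma exists_superset_card (T : finType) (A : {set T}) (k : nat) :
  #|A| <= k -> k <= #|T| -> exists2 C : {set T}, A \subset C & #|C| = k.
Proof.
move=> leAk lekT; have [|B sB cB] := @exists_subset_card T (~: A) (#|T| - k).
  by have := cardsC A; lia.
exists (~: B); first by rewrite -[A]setCK setCS.
by have := cardsC B; lia.
Qed.

Lemma turan_sum (n m : nat) (f : 'I_m.+1 -> nat) :
  \sum_(i < n) f (inord (i %% m.+1)) = ev (fun j : 'I_m.+1 => #|turan_part n j|) f.
Proof.
rewrite (partition_big (fun i : 'I_n => inord (i %% m.+1) : 'I_m.+1) predT) //=.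
apply: eq_bigr => j _; rewrite -sum1_card big_distrl /=.
rewrite [RHS]big_mkcond [LHS]big_mkcond; apply: eq_bigr => i _.
rewrite inE -val_eqE /= inordK ?ltn_pmod // mul1n.
case: eqP => // ij; congr f; apply: val_inj.
by rewrite /= inordK ?ltn_pmod.
Qed.

Lemma mem_turan3 (n m : nat) (u v w : 'I_n) :
  let col (i : 'I_n) : 'I_m.+1 := inord (i %% m.+1) in
  ([set u; v; w] \in turan3 n m.+1) =
  triangle (fun i j : 'I_m.+1 => i != j) (col u) (col v) (col w).
Proof.
move=> col; have partE (i : 'I_n) (j : 'I_m.+1) : (i \in turan_part n j) = (col i == j).
  by rewrite inE -val_eqE /= inordK ?ltn_pmod.
rewrite inE; apply/andP/and3P => [[/eqP c3 /forallP one]|[uv vw uw]].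
  have ne (i j : 'I_n) : i \in [set u; v; w] -> j \in [set u; v; w] -> i != j ->
      col i != col j.
    move=> ie je; apply: contra => /eqP cij; apply/eqP.
    have := card_le1_eqP (one (col j)) j i; rewrite !in_setI !partE cij eqxx.
    by rewrite ie je; apply.
  have [uv vw uw] : [/\ u != v, v != w & u != w].
    move: c3; rewrite -setUA !cardsU1 cards1 !inE.
    by case: (u == v); case: (u == w); case: (v == w).
  by split; apply: ne; rewrite ?inE ?eqxx ?orbT.
have neq i j : col i != col j -> i != j by apply: contraNneq => ->.
split.
  rewrite -setUA !cardsU1 cards1 !inE (negPf (neq _ _ uv)) (negPf (neq _ _ uw)).
  by rewrite (negPf (neq _ _ vw)).
apply/forallP=> j; apply/card_le1_eqP=> x y.
have cP z : z \in [set u; v; w] :&: turan_part n j ->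
    [\/ z = u, z = v | z = w] /\ col z = j.
  rewrite in_setI partE !inE => /andP[/orP[/orP[]|] /eqP-> /eqP]; split=> //;
    by [apply: Or31|apply: Or32|apply: Or33].
move=> /cP[xe xj] /cP[ye yj].
case: xe xj => -> xj; case: ye yj => -> yj //;
  by move: uv vw uw; rewrite xj yj eqxx.
Qed.

(** The Turan hypergraph consists of the triangles in the blow-up of a blue clique on the parts. *)
Lemma card_turan3 (n m : nat) :
  6 * #|turan3 n m.+1| = mono true (fun j : 'I_m.+1 => #|turan_part n j|).
Proof.
rewrite -sum_triples => [|e]; last by rewrite inE => /andP[/eqP].
rewrite /mono /weight [X in 3 * X]big1 => [|u _]; last by rewrite ev_const !muln0.
rewrite muln0 add0n -turan_sum; apply: eq_bigr => u _.
rewrite -turan_sum; apply: eq_bigr => v _; rewrite -turan_sum.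
by apply: eq_bigr => w _; rewrite mem_turan3.
Qed.

(** By [mono_blueE] the blue weight depends only on the first three power sums, which [sum_balanced]
    shows to agree with those of the Turan part sizes. *)
Lemma balanced_mono_turan3 (n m : nat) (T : finType) (U : {set T}) (z : T -> nat) :
  #|U| = m.+1 -> supp z \subset U -> mass z = n ->
  {in U &, forall u v, z u <= (z v).+1} -> mono true z = 6 * #|turan3 n m.+1|.
Proof.
move=> cU szU mz bal; pose t (j : 'I_m.+1) := #|turan_part n j|.
have z0 u : u \notin U -> z u = 0.
  by move=> uU; apply: contraNeq uU => zu; apply: (subsetP szU); rewrite inE.
have sumU (f : nat -> nat) : f 0 = 0 -> \sum_u f (z u) = \sum_(u in U) f (z u).
  move=> f0; rewrite [RHS]big_mkcond; apply: eq_bigr => u _.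
  by case: ifPn => // /z0->.
have tE j : t j = n %/ m.+1 + (j < n %% m.+1) by apply: card_turan_part.
have mt : mass t = n.
  have := turan_sum n (fun j : 'I_m.+1 => 1); rewrite sum1_card card_ord ev_const muln1.
  by move->.
have balt : {in [set: 'I_m.+1] &, forall i j, t i <= (t j).+1}.
  by move=> i j _ _; rewrite !tE; case: (i < _); case: (j < _); lia.
have setTE (g : 'I_m.+1 -> nat) : \sum_(j in [set: 'I_m.+1]) g j = \sum_j g j.
  by apply: eq_bigl => j; rewrite inE.
have cT : #|[set: 'I_m.+1]| = m.+1 by rewrite cardsT card_ord.
have sumz : \sum_(u in U) z u = n by rewrite -(sumU id).
have sumt : \sum_(j in [set: 'I_m.+1]) t j = n by rewrite setTE.
have sumzt (f : nat -> nat) : f 0 = 0 -> \sum_u f (z u) = \sum_j f (t j).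
  move=> f0; rewrite sumU // -setTE.
  by rewrite !sum_balanced ?cU ?cT // sumz sumt.
have e2 : ev z z = ev t t := sumzt (fun i => i * i) erefl.
have e3 : ev z (fun u => z u * z u) = ev t (fun u => t u * t u) :=
  sumzt (fun i => i * (i * i)) erefl.
rewrite card_turan3 -/t; have := mono_blueE z; have := mono_blueE t.
by rewrite mz mt e2 e3; lia.
Qed.

(** Two parts leave at least $(m-2)\lfloor n/m\rfloor$ outside, which is at least 3 in these ranges
    except for $m=4$, $n=7$, where two parts of size at most 2 still leave 3. *)
Lemma balanced_mono_red_le_blue (n m : nat) (T : finType) (U : {set T})
    (z : T -> nat) :
  5 <= m <= n \/ m = 4 /\ 7 <= n \/ m = 3 /\ 9 <= n ->
  #|U| = m -> supp z \subset U -> mass z = n ->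
  {in U &, forall u v, z u <= (z v).+1} -> mono false z <= mono true z.
Proof.
move=> large cU szU mz bal; apply: mono_red_le_blue => u v uv zu zv.
have uU : u \in U by apply: (subsetP szU); rewrite inE.
have vU : v \in U by apply: (subsetP szU); rewrite inE.
have [|qz _] := @balanced_parts _ U z _ bal; first by rewrite cU; lia.
have sumU : \sum_(w in U) z w = n.
  rewrite -mz /mass [LHS]big_mkcond; apply: eq_bigr => w _; case: ifPn => // wU.
  by apply/esym; apply: contraNeq wU => zw; apply: (subsetP szU); rewrite inE.
rewrite sumU cU in qz; set q := n %/ m in qz.
have : z u + (z v + (m - 2) * q) <= n.
  rewrite -sumU (bigD1 u) //= leq_add2l (bigD1 v) //=; last by rewrite vU eq_sym.
  rewrite leq_add2l -cU.
  have -> : #|U| - 2 = #|U :\ u :\ v|.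
    by have := cardsD1 u U; have := cardsD1 v (U :\ u); rewrite !inE uU vU eq_sym uv; lia.
  rewrite -sum_nat_const (eq_bigl (fun w => (w \in U) && (w != u) && (w != v))).
    by apply: leq_sum => w /andP[/andP[/qz/andP[]]].
  by move=> w; rewrite !inE; case: (w \in U); rewrite ?andbT ?andbF // andbC.
have /andP[_ zuq] := qz u uU; have /andP[_ zvq] := qz v vU.
have q_ge (d : nat) : 0 < m -> d * m <= n -> d <= q by move=> m0; rewrite /q leq_divRL.
have qm : q * m <= n by apply: leq_divM.
rewrite mz; case: large => [/andP[m5 mn]|[[m4 n7]|[m3 n9]]].
- by have := q_ge 1; nia.
- rewrite m4 in qm q_ge *; have := q_ge 1 isT; have := q_ge 2 isT.
  by case: (leqP 8 n); lia.
- by rewrite m3 in q_ge *; have := q_ge 3 isT; lia.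
Qed.

Theorem card_berge_free_le (n m : nat) (H : {set {set 'I_n}}) :
  5 <= m <= n \/ m = 4 /\ 7 <= n \/ m = 3 /\ 9 <= n ->
  uniform 3 H -> ~~ contains_berge (complete_graph m.+1) H ->
  #|H| <= #|turan3 n m|.
Proof.
move=> large /forall_inP H3 /red_blue_decomposition[H1 [R [sH1 R2 cardH clique]]].
have m_gt0 : 0 < m by lia.
pose r (u v : 'I_n) := [set u; v] \in R.
pose b (u v : 'I_n) := [set u; v] \in shadow H1.
have shadow2 (P : {set 'I_n}) : P \in shadow H1 -> #|P| = 2.
  by case/bigcupP=> e _; rewrite inE => /andP[_ /eqP].
have rC : symmetric r by move=> u v; rewrite /r setUC.
have bC : symmetric b by move=> u v; rewrite /b setUC.
have rI : irreflexive r.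
  by move=> u; apply/negbTE/negP => /R2[]; rewrite setUid cards1.
have bI : irreflexive b.
  by move=> u; apply/negbTE/negP => /shadow2; rewrite setUid cards1.
have dis u v : b u v -> ~~ r u v.
  by move=> buv; apply/negP => /R2[_]; rewrite [_ \in _]buv.
(* With unit weights red pairs are counted exactly, and each hyperedge of [H1] is a blue
   triangle. *)
have le_H : 6 * #|H| <= weight r b (fun=> 1).
  have ev1 (f : 'I_n -> nat) : ev (fun=> 1) f = \sum_u f u.
    by apply: eq_bigr => u _; rewrite mul1n.
  rewrite cardH mulnDr addnC; apply: leq_add.
    rewrite ev1; under [X in 3 * X]eq_bigr do rewrite ev1.
    by rewrite sum_pairs ?mulnA // => P /R2[].
  have H13 (e : {set 'I_n}) : e \in H1 -> #|e| = 3.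
    by move=> eH1; apply/eqP/H3/(subsetP sH1).
  rewrite -sum_triples // ev1; apply: leq_sum => u _.
  rewrite ev1; apply: leq_sum => v _; rewrite ev1; apply: leq_sum => w _.
  case: (boolP (_ \in H1)) => // uvw; rewrite lt0b.
  have c3 := H13 _ uvw.
  have [uv vw uw] : [/\ u != v, v != w & u != w].
    move: c3; rewrite -setUA !cardsU1 cards1 !inE.
    by case: (u == v); case: (u == w); case: (v == w).
  have inS (i j : 'I_n) : i != j -> i \in [set u; v; w] -> j \in [set u; v; w] -> b i j.
    move=> ij iS jS; apply/bigcupP; exists [set u; v; w] => //.
    by rewrite inE cards2 ij subUset !sub1set iS jS.
  by apply/and3P; split; apply: inS; rewrite // !inE eqxx ?orbT.
have [y [my wy cy]] := weight_le_clique (fun=> 1) rC rI bC bI.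
have mass1 : mass (fun _ : 'I_n => 1) = n by rewrite /mass /= sum1_card card_ord.
(* A larger support would contain an [m.+1]-set with every pair coloured. *)
have supp_le : #|supp y| <= m.
  have [//|lt_m] := leqP #|supp y| m; have [C sC cC] := exists_subset_card lt_m.
  have [P [sPC /eqP/cards2P[u [v [uv PE]]] nP]] := clique C cC; subst P.
  move: sPC; rewrite subUset !sub1set => /andP[uC vC].
  have := cy u v (subsetP sC _ uC) (subsetP sC _ vC) uv.
  by move: nP; rewrite in_setU negb_or => /andP[/negPf nb /negPf nr]; rewrite /r /b nb nr.
have mn : m <= #|'I_n| by rewrite card_ord; lia.
have [U sU cU] := exists_superset_card supp_le mn.
have le_turan blue : mono blue y <= 6 * #|turan3 n m|.
  have [z [szU mz le_z bal]] := mono_balance blue sU.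
  have mzn : mass z = n by rewrite mz my.
  have zT : mono true z = 6 * #|turan3 n m|.
    by case: m m_gt0 cU {large clique supp_le mn} => // m' _ cU;
       apply: balanced_mono_turan3 bal.
  apply: leq_trans le_z _; rewrite -zT; case: blue => //.
  exact: (balanced_mono_red_le_blue large cU szU mzn bal).
rewrite -(leq_pmul2l (isT : 0 < 6)); apply: leq_trans le_H (leq_trans wy _).
by have [le|le] := weight_le_mono y rC rI bC bI dis; apply: leq_trans le (le_turan _).
Qed.

(** * Exhaustive search *)

Fixpoint subs (k : nat) (s : seq nat) : seq (seq nat) :=
  match k, s with
  | 0, _ => [:: [::]]
  | _, [::] => [::]
  | k'.+1, a :: s' => [seq a :: t | t <- subs k' s'] ++ subs k s'
  end.

(* [memn] and [eqs] avoid unfolding the canonical structures of [nat] and [seq], *)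
(* and [if] stands for [&&] because the virtual machine is strict.               *)
Definition memn (s : seq nat) (v : nat) : bool := has (eqn v) s.

Fixpoint eqs (s t : seq nat) : bool :=
  match s, t with
  | [::], [::] => true
  | a :: s', b :: t' => if eqn a b then eqs s' t' else false
  | _, _ => false
  end.

Fixpoint sdr (ps es : seq (seq nat)) : bool :=
  if ps is p :: ps' then
    has (fun e => if all (memn e) p then sdr ps' [seq f <- es | ~~ eqs f e] else false) es
  else true.

Definition trace (S e : seq nat) : seq nat := filter (memn S) e.

(* A triple meeting [S] in just one pair can only serve that pair, so only the   *)
(* pairs that are not such a trace have to be matched into the triples inside [S]. *)
Definition berge_on (S : seq nat) (L : seq (seq nat)) : bool :=
  let traces := [seq trace S e | e <- L] in
  let uncovered := [seq p <- subs 2 S | ~~ has (eqs p) traces] in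
  let inner := [seq t <- traces | eqn (size t) 3] in
  if size uncovered <= size inner then sdr uncovered inner else false.

(** A new triple can only complete a Berge clique whose core contains two of its vertices. *)
Definition new_berge (Ss : seq (seq nat)) (e : seq nat) (L : seq (seq nat)) : bool :=
  has (fun S => if trace S e is _ :: _ :: _ then berge_on S (e :: L) else false) Ss.

Definition degr (L : seq (seq nat)) (v : nat) : nat := count (fun e => memn e v) L.

(* [L] is extended by a subset of the candidates [ts], all containing the new    *)
(* vertex [i]; a branch is cut when [i] can no longer have minimum degree or     *)
(* when some degree cannot reach [d].                                            *)
Fixpoint extensions (Ss : seq (seq nat)) (d i : nat) (ts L : seq (seq nat)) :
    seq (seq (seq nat)) :=
  let d' := maxn d (degr L i) in
  if all (fun v => d' <= degr (ts ++ L) v) (iota 0 i.+1) then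
    if ts is e :: ts' then
      extensions Ss d i ts' L ++
      (if new_berge Ss e L then [::] else extensions Ss d i ts' (e :: L))
    else [:: L]
  else [::].

(* Deleting a vertex of minimum degree from [m] triples on [n] vertices leaves   *)
(* at least [m - 3m/n] of them.                                                  *)
Fixpoint search (k n m : nat) : seq (seq (seq nat)) :=
  if n is i.+1 then
    let Ss := subs k (iota 0 n) in
    let links := rev [seq rcons p i | p <- subs 2 (iota 0 i)] in
    flatten [seq extensions Ss (m - size L) i links L
            | L <- search k i (m - (3 * m) %/ n)]
  else [:: [::]].

(** * Correctness of the search *)

Lemma mem_subs (k : nat) (s t : seq nat) :
  (t \in subs k s) = subseq t s && (size t == k).
Proof.
elim: s k t => [|a s IHs] [|k] t; try by case: t => [|b t]; rewrite ?inE ?andbF.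
rewrite /= mem_cat; case: t => [|b t].
  by rewrite IHs sub0seq andbF; apply/negP => /orP[/mapP[]|].
rewrite IHs /=; case: (eqVneq b a) => [->|ba] /=.
  rewrite mem_map => [|u v [] //]; rewrite IHs eqSS.
  case: (boolP (subseq t s)) => /= ts; last first.
    by apply/negbTE; apply: contra ts => /andP[/cons_subseq].
  by case: eqP => //= _; rewrite andbF.
by rewrite orb_idl // => /mapP[u _ [E _]]; rewrite E eqxx in ba.
Qed.

Lemma subs_uniq (k : nat) (s : seq nat) : uniq s -> uniq (subs k s).
Proof.
elim: s k => [|a s IHs] [|k] //= /andP[nas us].
rewrite cat_uniq map_inj_uniq => [|u v [] //]; rewrite !IHs //= andbT.
apply/hasPn => t; rewrite mem_subs => /andP[/mem_subseq ts _].
by apply/mapP => -[u _ tE]; rewrite (ts a) ?tE ?mem_head in nas.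
Qed.

Lemma memnE (s : seq nat) (v : nat) : memn s v = (v \in s).
Proof. by elim: s => //= a s IHs; rewrite inE -IHs. Qed.

Lemma eqsE (s t : seq nat) : eqs s t = (s == t).
Proof.
elim: s t => [|a s IHs] [|b t] //=; rewrite eqseq_cons IHs.
by rewrite -[eqn a b]/(a == b); case: eqP.
Qed.

Lemma traceE (S e : seq nat) : trace S e = [seq v <- e | v \in S].
Proof. by apply: eq_filter => v; rewrite memnE. Qed.

Lemma sdrP (ps es : seq (seq nat)) : uniq ps -> sdr ps es ->
  exists2 F : seq nat -> seq nat,
    {in ps, forall p, F p \in es /\ {subset p <= F p}} & {in ps &, injective F}.
Proof.
elim: ps es => [|p ps IHps] es /=; first by exists id.
case/andP=> nps ups /hasP[e ees]; case: ifP => // /allP sub_pe /(IHps _ ups)[F Fin FI].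
have Fe q : q \in ps -> F q \in es /\ F q != e.
  by case/Fin; rewrite mem_filter eqsE eq_sym => /andP[].
exists (fun q => if q == p then e else F q) => [q|q r]; rewrite !inE.
  case: eqP => [-> _|_ /= qps]; last by have [? _] := Fe q qps; have [] := Fin q qps.
  by split=> // v /sub_pe; rewrite memnE.
case: eqP => [->|_] /=; case: eqP => [->|_] //= qps rps.
- by move=> E; have [_] := Fe r rps; rewrite -E eqxx.
- by move=> E; have [_] := Fe q qps; rewrite E eqxx.
- exact: FI.
Qed.

Definition triple (i : nat) (e : seq nat) : bool := subseq e (iota 0 i) && (size e == 3).

Lemma subseq_iota (i : nat) (e : seq nat) :
  subseq e (iota 0 i) = sorted ltn e && all (gtn i) e.
Proof.
apply/idP/andP => [sub|[se /allP ei]].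
  split; first exact: (subseq_sorted ltn_trans sub (iota_ltn_sorted 0 i)).
  by apply/allP => v /(mem_subseq sub); rewrite mem_iota.
apply/subseq_uniqP; first exact: iota_uniq.
apply: (irr_sorted_eq ltn_trans ltnn) => //.
  exact: (subseq_sorted ltn_trans (filter_subseq _ _) (iota_ltn_sorted 0 i)).
move=> v; rewrite mem_filter mem_iota /= add0n.
by case: (boolP (v \in e)) => //= /ei.
Qed.

Lemma triple_lt (i v : nat) (e : seq nat) : triple i e -> v \in e -> v < i.
Proof. by rewrite /triple subseq_iota => /andP[/andP[_ /allP ei] _] /ei. Qed.

Lemma tripleS (i : nat) (e : seq nat) :
  triple i.+1 e = triple i e || (e \in [seq rcons p i | p <- subs 2 (iota 0 i)]).
Proof.
case/lastP: e => [|e v]; first by rewrite /triple !andbF; apply/esym/mapP => -[[|? ?]].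
have -> : (rcons e v \in [seq rcons p i | p <- subs 2 (iota 0 i)]) =
    (v == i) && (e \in subs 2 (iota 0 i)).
  apply/mapP/andP => [[p pin /rcons_inj[-> ->]]|[/eqP-> pin]]; first by rewrite eqxx.
  by exists e.
rewrite mem_subs /triple !subseq_iota size_rcons eqSS !all_rcons /=.
case: (size e == 2); rewrite ?andbF //= !andbT.
have lti u w : sorted ltn (rcons e u) -> u <= w -> sorted ltn e && all (gtn w) e.
  move=> s uw; rewrite (subseq_sorted ltn_trans (subseq_rcons e u) s) /=.
  apply/allP => a ae; apply: leq_trans uw.
  move: s; rewrite -cats1 => /(subseq_sorted ltn_trans (s1 := [:: a; u])) /=.
  rewrite andbT; apply; rewrite -[[:: a; u]]/([:: a] ++ [:: u]).
  by apply: cat_subseq => //; rewrite sub1seq.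
have ltS u : sorted ltn e -> all (gtn u) e -> sorted ltn (rcons e u).
  case: e {lti} => //= a e se; rewrite rcons_path se /= => /andP[au /allP eu].
  by have := mem_last a e; rewrite inE => /predU1P[->//|/eu].
apply/idP/idP => [/and3P[sev ltvi _]|/orP[/and3P[sev ltvi alle]|]].
- rewrite ltnS leq_eqVlt in ltvi; have /andP[se alle] := lti v v sev (leqnn v).
  case/predU1P: ltvi => [vi|ltvi]; first by rewrite -vi eqxx se alle orbT.
  rewrite sev ltvi /=; apply/orP; left; apply: sub_all alle => a /=.
  by move/ltn_trans; apply.
- rewrite sev /= ltnS (ltnW ltvi) /=; apply: sub_all alle => a /=; exact: ltnW.
- case/and3P=> /eqP-> se alle; rewrite ltS // ltnSn /=.
  by apply: sub_all alle => a /=; apply: ltnW.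
Qed.

Section Search.

Variables (T : finType) (H : {set {set T}}).
Hypothesis H3 : uniform 3 H.

Definition set_of (x : nat -> T) (e : seq nat) : {set T} := [set:: map x e].

(** [x] numbers the vertices; the search sees a hyperedge as the increasing list of its indices. *)
Definition edge (x : nat -> T) (i : nat) (e : seq nat) : bool :=
  triple i e && (set_of x e \in H).

Lemma mem_set_of (x : nat -> T) (i v : nat) (e : seq nat) :
  {in gtn i &, injective x} -> triple i e -> v < i -> (x v \in set_of x e) = (v \in e).
Proof.
move=> xI te vi; rewrite inE; apply/mapP/idP => [[u ue xuv]|ve]; last by exists v.
by rewrite (xI v u) // -topredE /=; apply: triple_lt ue.
Qed.

Lemma set_of_inj (x : nat -> T) (i : nat) : {in gtn i &, injective x} ->
  {in triple i &, injective (set_of x)}.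
Proof.
move=> xI e f te tf ef; rewrite -!topredE /= in te tf.
have sortd g : triple i g -> sorted ltn g.
  by rewrite /triple subseq_iota => /andP[/andP[]].
apply: (irr_sorted_eq ltn_trans ltnn); try exact: sortd.
move=> v; case: (ltnP v i) => vi; first by rewrite -!(mem_set_of xI _ vi) // ef.
have nin g : triple i g -> (v \in g) = false.
  by move=> tg; apply: contraTF vi => /(triple_lt tg); rewrite -ltnNge.
by rewrite !nin.
Qed.

Lemma card_edges (x : nat -> T) (i : nat) (L : seq (seq nat)) (p : pred {set T}) :
  {in gtn i &, injective x} -> uniq L -> (forall e, (e \in L) = edge x i e) ->
  #|[set E in H | (E \subset [set:: map x (iota 0 i)]) && p E]| =
  count (fun e => p (set_of x e)) L.
Proof.
move=> xI uL mL; pose F := [seq e <- L | p (set_of x e)].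
have xinj (e : seq nat) : {in e, forall v, v < i} -> {in e &, injective x}.
  by move=> ei u v ue ve; apply: xI; rewrite -topredE /= ei.
have FI : {in F &, injective (set_of x)}.
  move=> e f; rewrite !mem_filter !mL => /and3P[_ te _] /and3P[_ tf _].
  exact: (set_of_inj xI).
have uF : uniq (map (set_of x) F) by rewrite map_inj_in_uniq // filter_uniq.
rewrite -size_filter -(size_map (set_of x)) -(card_uniqP uF).
apply: eq_card => E; rewrite inE; apply/and3P/mapP => [[EH EW pE]|].
  pose e := [seq v <- iota 0 i | x v \in E].
  have eE : set_of x e = E.
    apply/setP=> w; rewrite inE; apply/mapP/idP => [[v]|wE].
      by rewrite mem_filter => /andP[xvE _] ->.
    have := subsetP EW w wE; rewrite inE => /mapP[v vi wv].
    by exists v => //; rewrite mem_filter -wv wE.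
  have ue : uniq (map x e).
    rewrite map_inj_in_uniq ?filter_uniq ?iota_uniq //.
    by apply: xinj => v; rewrite mem_filter mem_iota => /andP[_ /andP[]].
  exists e => //; rewrite mem_filter mL /edge /triple eE pE EH andbT filter_subseq.
  have := forall_inP H3 E EH; rewrite -{1}eE cardsE => /eqP <-.
  by rewrite (card_uniqP ue) size_map /=.
case=> e; rewrite mem_filter mL => /and3P[pe te eH] ->; split=> //.
apply/subsetP=> w; rewrite !inE => /mapP[v ve ->].
by apply: map_f; rewrite mem_iota /= (triple_lt te ve).
Qed.

(** Pairs that are traces use a triple with that trace, the others use the triples found by [sdr].
    Traces of sizes 2 and 3 keep the two kinds distinct. *)
Lemma berge_onP (k : nat) (x : nat -> T) (i : nat) (S : seq nat) (L : seq (seq nat)) :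
  {in gtn i &, injective x} -> S \in subs k (iota 0 i) ->
  {in L, forall e, edge x i e} -> berge_on S L ->
  contains_berge (complete_graph k) H.
Proof.
move=> xI; rewrite mem_subs subseq_iota => /andP[/andP[sS /allP Si] /eqP szS] Ledge.
have uS : uniq S by apply: sorted_uniq sS; [apply: ltn_trans|apply: ltnn].
rewrite /berge_on; case: ifP => // _ /sdrP[|F FP FI].
  by rewrite filter_uniq // subs_uniq.
have xS : {in S &, injective x} by move=> u v uS' vS'; apply: xI; exact: Si.
pose pre (P : {set T}) := [seq v <- S | x v \in P].
have preP (P : {set T}) : P \subset set_of x S -> #|P| = 2 ->
    pre P \in subs 2 S /\ set_of x (pre P) = P.
  move=> sPC cP; have preK : set_of x (pre P) = P.
    apply/setP=> w; rewrite inE; apply/mapP/idP => [[v]|wP].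
      by rewrite mem_filter => /andP[xvP _] ->.
    have := subsetP sPC w wP; rewrite inE => /mapP[v vS wv].
    by exists v => //; rewrite mem_filter -wv wP.
  have up : uniq (map x (pre P)).
    rewrite map_inj_in_uniq ?filter_uniq // => u v; rewrite !mem_filter.
    by move=> /andP[_ uS'] /andP[_ vS']; apply: xS.
  by split=> //; rewrite mem_subs filter_subseq -cP -{2}preK cardsE (card_uniqP up) size_map /=.
pose cov (p : seq nat) := ohead [seq e <- L | trace S e == p].
have covP p e : cov p = Some e -> e \in L /\ trace S e = p.
  rewrite /cov; case E: [seq _ <- L | _] => [|f s] //= [<-].
  have : f \in [seq e <- L | trace S e == p] by rewrite E mem_head.
  by rewrite mem_filter => /andP[/eqP].
have uncovP p : p \in subs 2 S -> cov p = None ->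
    [/\ p \in [seq p <- subs 2 S | ~~ has (eqs p) [seq trace S e | e <- L]],
        F p \in L, size (trace S (F p)) = 3 & {subset p <= F p}].
  move=> pS; rewrite /cov; case E: [seq _ <- L | _] => // _.
  have pU : p \in [seq p <- subs 2 S | ~~ has (eqs p) [seq trace S e | e <- L]].
    rewrite mem_filter pS andbT; apply/hasPn => _ /mapP[e eL ->]; rewrite eqsE eq_sym.
    by apply/negP => pe; have := mem_filter (fun e => trace S e == p) e L;
       rewrite E eL pe.
  have [] := FP p pU; rewrite mem_filter => /andP[/eqP sz3 /mapP[e eL FpE]] sub_p.
  have /andP[/andP[_ /eqP e3] _] := Ledge e eL.
  have Ee : trace S e = e.
    by apply/all_filterP; rewrite all_count -size_filter -/(trace S e) -FpE sz3 e3.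
  by split=> //; rewrite FpE ?Ee // -FpE.
pose G p := if cov p is Some e then e else F p.
have GP p : p \in subs 2 S -> G p \in L /\ {subset p <= G p}.
  move=> pS; rewrite /G; case E: (cov p) => [e|]; last by have [] := uncovP p pS E.
  have [eL <-] := covP p e E; split=> // v.
  by rewrite traceE mem_filter => /andP[].
have sz2 p : p \in subs 2 S -> size p = 2 by rewrite mem_subs => /andP[_ /eqP].
have GI : {in subs 2 S &, injective G}.
  move=> p q pS qS; rewrite /G; case Ep: (cov p) => [e|]; case Eq: (cov q) => [f|].
  - by have [_ <-] := covP p e Ep; have [_ <-] := covP q f Eq; move->.
  - move=> eF; have [_ _ sz3 _] := uncovP q qS Eq; have [_ te] := covP p e Ep.
    by move: sz3; rewrite -eF te sz2.
  - move=> eF; have [_ _ sz3 _] := uncovP p pS Ep; have [_ te] := covP q f Eq.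
    by move: sz3; rewrite eF te sz2.
  - have [pU _ _ _] := uncovP p pS Ep; have [qU _ _ _] := uncovP q qS Eq.
    exact: FI.
apply: (@berge_clique_of_sdr _ k H (set_of x S) (fun P => set_of x (G (pre P)))).
- have uxS : uniq (map x S) by rewrite map_inj_in_uniq.
  by rewrite cardsE (card_uniqP uxS) size_map.
- move=> P sPC cP; have [pS preK] := preP P sPC cP; have [GL subG] := GP _ pS.
  have /andP[_ ->] := Ledge _ GL; split=> //; rewrite -{1}preK.
  by apply/subsetP=> w; rewrite !inE => /mapP[v /subG vG ->]; apply: map_f.
move=> P Q sPC cP sQC cQ; have [pS preK] := preP P sPC cP.
have [qS preK'] := preP Q sQC cQ; have [GL _] := GP _ pS; have [GL' _] := GP _ qS.
have /andP[tp _] := Ledge _ GL; have /andP[tq _] := Ledge _ GL'.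
by move/(set_of_inj xI tp tq)/(GI _ _ pS qS) => pq; rewrite -preK pq.
Qed.

Lemma new_bergeP (k : nat) (x : nat -> T) (i : nat) (e : seq nat) (L : seq (seq nat)) :
  {in gtn i &, injective x} -> {in e :: L, forall f, edge x i f} ->
  new_berge (subs k (iota 0 i)) e L -> contains_berge (complete_graph k) H.
Proof.
move=> xI Ledge /hasP[S Sin].
by case: (trace S e) => [|? [|? ?]] //; apply: (berge_onP xI Sin Ledge).
Qed.

Lemma degr_cat (L L' : seq (seq nat)) (v : nat) :
  degr (L ++ L') v = degr L v + degr L' v.
Proof. exact: count_cat. Qed.

(** Following the actual hyperedges [h] is never cut: degrees at [i] only grow along the branch, and
    those of [ts ++ L] bound the final ones from above. *)
Lemma extensions_complete (Ss : seq (seq nat)) (d i : nat) (h : pred (seq nat))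
    (ts L : seq (seq nat)) :
  (forall e L', h e -> all h L' -> ~~ new_berge Ss e L') -> all h L ->
  let L' := catrev (filter h ts) L in
  (forall v, v <= i -> maxn d (degr L' i) <= degr L' v) ->
  L' \in extensions Ss d i ts L.
Proof.
move=> noB; elim: ts L => [|e ts IHts] L hL L' minL'.
  have : all (fun v => maxn d (degr L i) <= degr L v) (iota 0 i.+1).
    by apply/allP => v; rewrite mem_iota => /minL'.
  by rewrite /L' /= => ->; apply: mem_head.
have degE v : degr L' v = degr (filter h (e :: ts)) v + degr L v.
  by rewrite /L' catrevE degr_cat /degr count_rev.
have filt v : degr (filter h (e :: ts)) v <= degr (e :: ts) v.
  by rewrite /degr count_filter; apply: sub_count => f /andP[].
have : all (fun v => maxn d (degr L i) <= degr ((e :: ts) ++ L) v) (iota 0 i.+1).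
  apply/allP => v; rewrite mem_iota => /minL'.
  by rewrite degr_cat; move: (filt v) (degE v) (degE i); lia.
rewrite /= => ->; rewrite mem_cat; move: minL'; rewrite /L' /=.
case: ifP => he minL'; last by rewrite IHts.
by rewrite (negPf (noB e L he hL)) IHts ?orbT //= he.
Qed.

Lemma sum_degrees (W : {set T}) :
  \sum_(w in W) #|[set E in H | (E \subset W) && (w \in E)]| =
  3 * #|[set E in H | E \subset W]|.
Proof.
have E w : #|[set E in H | (E \subset W) && (w \in E)]| =
    \sum_(E in [set E in H | E \subset W]) (w \in E).
  by rewrite -sum1dep_card [RHS]big_mkcond [LHS]big_mkcond; apply: eq_bigr => E _;
     rewrite inE; case: (E \in H); case: (E \subset W); case: (w \in E).
rewrite (eq_bigr _ (fun w _ => E w)) exchange_big /= mulnC -sum_nat_const.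
apply: eq_bigr => e; rewrite inE => /andP[eH eW].
have <- : #|e| = 3 by apply/eqP; apply: (forall_inP H3).
rewrite -sum1_card [RHS]big_mkcond [LHS]big_mkcond; apply: eq_bigr => w _.
case: (boolP (w \in e)) => [/(subsetP eW)->//|_]; first by case: ifP.
Qed.

(** A vertex of minimum degree in [W] is deleted and gets the last index; the hypergraph left on
    [W :\ w0] is found by induction, and [w0] has degree at least [m] minus its size. *)
Lemma search_complete (x0 : T) (k n m : nat) (W : {set T}) :
  ~~ contains_berge (complete_graph k) H ->
  #|W| = n -> m <= #|[set E in H | E \subset W]| ->
  exists x L, [/\ {in gtn n &, injective x}, [set:: map x (iota 0 n)] = W,
    uniq L, forall e, (e \in L) = edge x n e & L \in search k n m].
Proof.
move=> freeH; elim: n m W => [|i IHn] m W cW le_m.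
  exists (fun=> x0), [::]; split=> //.
    by rewrite (cards0_eq cW); apply/setP=> w; rewrite !inE.
  by case.
pose deg w := #|[set E in H | (E \subset W) && (w \in E)]|.
have /card_gt0P[w1 w1W] : 0 < #|W| by rewrite cW.
have [w0 w0W min_w0] := @arg_minnP _ w1 (mem W) deg w1W.
have {}w0W : w0 \in W by [].
pose h := #|[set E in H | E \subset W]|.
have le_deg : deg w0 <= (3 * h) %/ i.+1.
  rewrite leq_divRL // -sum_degrees -cW mulnC -sum_nat_const.
  by apply: leq_sum => w /min_w0.
have split_h : #|[set E in H | E \subset W :\ w0]| + deg w0 = h.
  rewrite /h -(cardsID [set E : {set T} | w0 \in E] [set E in H | E \subset W]) addnC.
  congr (_ + _); apply: eq_card => E; rewrite !inE; first by rewrite andbA.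
  by rewrite subsetD1 [RHS]andbC -andbA; congr (_ && _).
have le_m' : m - (3 * m) %/ i.+1 <= #|[set E in H | E \subset W :\ w0]|.
  have : m - (3 * m) %/ i.+1 <= h - (3 * h) %/ i.+1.
    (* From three vertices on, $m - \lfloor 3m/(i+1)\rfloor$ is nondecreasing in $m$; below that the
       truncated difference is 0. *)
    case: (leqP 3 i.+1) => i3.
      have : (3 * h) %/ i.+1 <= (h - m) + (3 * m) %/ i.+1.
        rewrite -divnMDl //; apply: leq_div2r; rewrite /h in le_m *; nia.
      by rewrite /h in le_m *; lia.
    have : m <= (3 * m) %/ i.+1 by rewrite leq_divRL // mulnC leq_mul2r ltnW ?orbT.
    by lia.
  by lia.
have cW' : #|W :\ w0| = i by have := cardsD1 w0 W; rewrite w0W cW => -[].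
have [x' [L' [x'I x'W uL' mL' L'in]]] := IHn _ _ cW' le_m'.
pose x v := if v == i then w0 else x' v.
have xE v : v < i -> x v = x' v by rewrite /x ltn_neqAle => /andP[/negPf->].
have xi : x i = w0 by rewrite /x eqxx.
have x'in v : v < i -> x' v \in W :\ w0.
  by move=> vi; rewrite -x'W inE map_f // mem_iota.
have xI : {in gtn i.+1 &, injective x}.
  move=> u v; rewrite -!topredE /= !ltnS leq_eqVlt [v <= i]leq_eqVlt.
  case/predU1P=> [->|ui]; case/predU1P=> [->|vi] //; rewrite ?xi ?xE //.
  - by move=> E; have := x'in v vi; rewrite -E setD11.
  - by move=> E; have := x'in u ui; rewrite E setD11.
  - exact: x'I.
have xW : [set:: map x (iota 0 i.+1)] = W.
  have memW' w : (w \in map x' (iota 0 i)) = (w \in W :\ w0) by rewrite -x'W inE.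
  apply/setP=> w; rewrite inE -addn1 iotaD map_cat mem_cat add0n /= xi mem_seq1.
  have -> : map x (iota 0 i) = map x' (iota 0 i).
    by apply/eq_in_map => v; rewrite mem_iota => /xE.
  by rewrite memW' in_setD1; case: (eqVneq w w0) => [->|_]; rewrite ?w0W ?orbF.
have edgeE e : triple i e -> edge x i.+1 e = (e \in L').
  move=> te; rewrite mL' /edge tripleS te /=; congr (_ \in H).
  rewrite /set_of; suff -> : map x e = map x' e by [].
  by apply/eq_in_map => v /(triple_lt te)/xE.
pose links := [seq rcons p i | p <- subs 2 (iota 0 i)].
(* The exact list that [extensions] builds by consing the chosen links onto [L']. *)
pose R := catrev (filter (edge x i.+1) (rev links)) L'.
have i_link e : e \in links -> i \in e.
  by case/mapP=> p _ ->; rewrite mem_rcons mem_head.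
have linkN e : e \in links -> ~~ triple i e.
  by move/i_link => ie; apply/negP => /triple_lt /(_ ie); rewrite ltnn.
have L'triple e : e \in L' -> triple i e by rewrite mL' => /andP[].
have mR e : (e \in R) = edge x i.+1 e.
  rewrite /R catrevE mem_cat mem_rev mem_filter mem_rev.
  case: (boolP (triple i e)) => te; first by rewrite -edgeE //; case: (edge _ _ _); rewrite ?orbT.
  rewrite (contraNF (L'triple e)) // orbF.
  rewrite andbC; apply: andb_idl; rewrite /edge tripleS (negPf te) /=.
  by case/andP.
have uR : uniq R.
  rewrite /R catrevE cat_uniq rev_uniq filter_uniq ?uL' ?andbT /=; last first.
    rewrite rev_uniq map_inj_uniq ?subs_uniq ?iota_uniq // => p q /rcons_inj[].
    by move->.
  apply/hasPn => e /L'triple te; rewrite mem_rev mem_filter mem_rev.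
  by rewrite negb_and; apply/orP; right; apply: contraL te; apply: linkN.
have sizeL' : size L' = #|[set E in H | E \subset W :\ w0]|.
  rewrite -x'W -(count_predT L') -(card_edges predT x'I uL' mL').
  by apply: eq_card => E; rewrite !inE andbT.
have degR v : v <= i -> degr R v = deg (x v).
  move=> vi; rewrite /deg -xW (card_edges (fun E => x v \in E) xI uR mR).
  apply: eq_in_count => e; rewrite mR memnE => /andP[te _].
  by rewrite (mem_set_of xI te).
exists x, R; split=> //=; apply/flatten_mapP; exists L' => //.
apply: extensions_complete => [e L1 he hL1||v vi].
- apply/negP => /(new_bergeP xI) free'; case/negP: freeH; apply: free' => f.
  by rewrite inE => /predU1P[->//|/(allP hL1)].
- by apply/allP => e eL'; rewrite edgeE // L'triple.
rewrite -/links -/R !degR // xi geq_max min_w0 ?andbT; last first.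
  by rewrite inE -xW inE map_f // mem_iota.
apply: leq_trans (min_w0 (x v) _); last by rewrite inE -xW inE map_f // mem_iota.
by move: le_m; rewrite -/h sizeL'; lia.
Qed.

End Search.

(** * Small cases by computation *)

Lemma search_nil_bound (k n m : nat) (H : {set {set 'I_n.+1}}) :
  uniform 3 H -> ~~ contains_berge (complete_graph k) H ->
  search k n.+1 m.+1 = [::] -> #|H| <= m.
Proof.
move=> H3 freeH nil; rewrite leqNgt; apply/negP => lt_m.
have [||x [L [_ _ _ _]]] := search_complete H3 ord0 (n := n.+1) (m := m.+1) (W := setT) freeH.
- by rewrite cardsT card_ord.
- apply: leq_trans lt_m _; apply: subset_leq_card; apply/subsetP => E EH.
  by rewrite inE EH subsetT.
by rewrite nil.
Qed.

(** In this and the following computations the last argument is one more than the claimed extremal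
    number for the given [k] and [n]. *)
Lemma search_4_5 : search 4 5 6 = [::].
Proof. by vm_cast_no_check (@erefl (seq (seq (seq nat))) [::]). Qed.

Lemma search_4_6 : search 4 6 9 = [::].
Proof. by vm_cast_no_check (@erefl (seq (seq (seq nat))) [::]). Qed.

Lemma search_4_7 : search 4 7 13 = [::].
Proof. by vm_cast_no_check (@erefl (seq (seq (seq nat))) [::]). Qed.

Lemma search_4_8 : search 4 8 19 = [::].
Proof. by vm_cast_no_check (@erefl (seq (seq (seq nat))) [::]). Qed.

Lemma search_5_5 : search 5 5 10 = [::].
Proof. by vm_cast_no_check (@erefl (seq (seq (seq nat))) [::]). Qed.

Lemma search_5_6 : search 5 6 13 = [::].
Proof. by vm_cast_no_check (@erefl (seq (seq (seq nat))) [::]). Qed.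

(** * Lower bounds and assembly of the cases *)

Lemma ex3_berge_eq (n v : nat) (V : finType) (F : {set {set V}}) (H0 : {set {set 'I_n}}) :
  (forall H : {set {set 'I_n}}, uniform 3 H -> ~~ contains_berge F H -> #|H| <= v) ->
  uniform 3 H0 -> ~~ contains_berge F H0 -> #|H0| = v -> ex3_berge n F = v.
Proof.
move=> upper uH0 fH0 cH0; apply/eqP; rewrite eqn_leq; apply/andP; split.
  by apply/bigmax_leqP => H /andP[]; apply: upper.
by rewrite -cH0 /ex3_berge (bigD1 H0) ?uH0 //= leq_maxl.
Qed.

Lemma few_edges_free (T : finType) (k : nat) (H : {set {set T}}) :
  #|H| < 'C(k, 2) -> ~~ contains_berge (complete_graph k) H.
Proof.
move=> few; apply/negP => /contains_bergeP[phi [f [_ fI fH _]]].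
have sFH : f @: complete_graph k \subset H.
  by apply/subsetP => _ /imsetP[e eF ->]; apply: fH.
have := subset_leq_card sFH; rewrite card_in_imset // card_draws card_ord.
by rewrite leqNgt few.
Qed.

Lemma uniform_card_le (n : nat) (H : {set {set 'I_n}}) : uniform 3 H -> #|H| <= 'C(n, 3).
Proof.
move/forall_inP=> H3; have <- : #|[set e : {set 'I_n} | #|e| == 3]| = 'C(n, 3).
  by rewrite card_draws card_ord.
by apply: subset_leq_card; apply/subsetP => e /H3; rewrite inE.
Qed.

Lemma uniform_exists (n v : nat) : v <= 'C(n, 3) ->
  exists2 H : {set {set 'I_n}}, uniform 3 H & #|H| = v.
Proof.
move=> le_v; have [|H sH cH] := @exists_subset_card _ [set e : {set 'I_n} | #|e| == 3] v.
  by rewrite card_draws card_ord.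
by exists H => //; apply/forall_inP => e /(subsetP sH); rewrite inE.
Qed.

Lemma ex3_berge_few (n k v : nat) : v <= 'C(n, 3) -> v < 'C(k, 2) ->
  (forall H : {set {set 'I_n}}, uniform 3 H ->
     ~~ contains_berge (complete_graph k) H -> #|H| <= v) ->
  ex3_berge n (complete_graph k) = v.
Proof.
move=> /uniform_exists[H H3 cH] few upper.
by apply: (ex3_berge_eq upper H3 _ cH); apply: few_edges_free; rewrite cH.
Qed.

Lemma uniform_turan3 (n m : nat) : uniform 3 (turan3 n m).
Proof. by apply/forall_inP => e; rewrite inE => /andP[]. Qed.

(** By pigeonhole two of the [m.+1] core vertices share a part, and no hyperedge contains both. *)
Lemma turan3_free (n m : nat) : 0 < m ->
  ~~ contains_berge (complete_graph m.+1) (turan3 n m).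
Proof.
case: m => // m _; apply/negP => /contains_bergeP[phi [f [phiI _ fH fsub]]].
pose col (i : 'I_m.+2) : 'I_m.+1 := inord (phi i %% m.+1).
have /injectivePn[i [j ij cij]] : ~~ injectiveb col.
  apply/negP => /injectiveP /leq_card; rewrite !card_ord; lia.
have ijF : [set i; j] \in complete_graph m.+2 by rewrite inE cards2 ij.
have := fH _ ijF; rewrite inE => /andP[_ /forallP/(_ (col j))/card_le1_eqP one].
have mem_part a : a \in [set i; j] -> col a = col j ->
    phi a \in f [set i; j] :&: turan_part n (col j).
  move=> aij caj; rewrite inE (subsetP (fsub _ ijF)) ?imset_f //=.
  by rewrite inE -caj /= inordK ?ltn_pmod.
have := one _ _ (mem_part i _ cij) (mem_part j _ erefl).
by rewrite !inE !eqxx orbT => /(_ isT isT)/phiI/esym/eqP; rewrite (negPf ij).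
Qed.

Lemma turan3_all (n m : nat) (e : {set 'I_n}) : n <= m -> #|e| == 3 -> e \in turan3 n m.
Proof.
move=> nm e3; rewrite inE e3; apply/forallP => j; apply/card_le1_eqP => u v.
rewrite !inE => /andP[_ /eqP uj] /andP[_ /eqP vj]; apply: val_inj => /=.
by move: uj vj; rewrite !modn_small ?(leq_trans (ltn_ord _)) // => -> ->.
Qed.

(** The power-sum identity with explicit part sizes, which reduces the small Turan numbers to
    arithmetic. *)
Lemma card_turan3_small (n m : nat) (t := fun j : 'I_m.+1 => n %/ m.+1 + (j < n %% m.+1)) :
  6 * #|turan3 n m.+1| + 3 * n * (\sum_j t j * t j) =
  n ^ 3 + 2 * \sum_j t j * (t j * t j).
Proof.
pose c (j : 'I_m.+1) := #|turan_part n j|.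
have ct : c =1 t by move=> j; apply: card_turan_part.
have mc : mass c = n.
  have := turan_sum n (fun j : 'I_m.+1 => 1); rewrite sum1_card card_ord ev_const muln1.
  by move->.
have := mono_blueE c; rewrite card_turan3 -/c mc /ev.
under [in 3 * n * _]eq_bigr do rewrite ct.
by under [in 2 * _]eq_bigr do rewrite ct.
Qed.

Lemma turan3_sizes : [/\ #|turan3 6 3| = 8, #|turan3 7 3| = 12, #|turan3 8 3| = 18
  & #|turan3 6 4| = 12].
Proof.
split.
- by have := card_turan3_small 6 2; rewrite /= (_ : 6 %/ 3 = 2) // !big_ord_recl !big_ord0 /=; lia.
- by have := card_turan3_small 7 2; rewrite /= (_ : 7 %/ 3 = 2) // !big_ord_recl !big_ord0 /=; lia.
- by have := card_turan3_small 8 2; rewrite /= (_ : 8 %/ 3 = 2) // !big_ord_recl !big_ord0 /=; lia.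
- by have := card_turan3_small 6 3; rewrite /= (_ : 6 %/ 4 = 1) // !big_ord_recl !big_ord0 /=; lia.
Qed.

Theorem corollary23 (n k : nat) (hn : 1 <= n) (hk : 4 <= k) :
  [/\ 6 <= k \/ (k = 5 /\ 6 <= n) \/ (k = 4 /\ 6 <= n) ->
        ex3_berge n (complete_graph k) = #|turan3 n (k - 1)|,
      (k = 5 /\ n <= 4) \/ (k = 4 /\ n <= 4) ->
        ex3_berge n (complete_graph k) = 'C(n, 3),
      k = 4 /\ n = 5 -> ex3_berge n (complete_graph k) = 5
    & k = 5 /\ n = 5 -> ex3_berge n (complete_graph k) = 9].
Proof.
split=> [range|range|[-> ->]|[-> ->]].
- case: k hk range => // m hk range; rewrite subn1 /=.
  have m_gt0 : 0 < m by lia.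
  apply: (ex3_berge_eq _ (uniform_turan3 n m) (turan3_free n m_gt0)) => // H H3 freeH.
  case: (leqP n m) => [le_nm|lt_mn].
    apply: subset_leq_card; apply/subsetP => e /(forall_inP H3).
    exact: turan3_all.
  (* In the small cases the balanced red weighting beats the blue one, for example 21 against 18 for
     $m=3$, $n=8$, so the general bound is too weak there. *)
  have [large|small] : (5 <= m <= n \/ m = 4 /\ 7 <= n \/ m = 3 /\ 9 <= n) \/
      (m = 3 /\ (n = 6 \/ n = 7 \/ n = 8) \/ m = 4 /\ n = 6) by lia.
    exact: card_berge_free_le.
  have [s63 s73 s83 s64] := turan3_sizes.
  case: small => [[m3 [n6|[n7|n8]]]|[m4 n6]]; subst m n.
  + by rewrite s63; apply: search_nil_bound freeH search_4_6.
  + by rewrite s73; apply: search_nil_bound freeH search_4_7.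
  + by rewrite s83; apply: search_nil_bound freeH search_4_8.
  + by rewrite s64; apply: search_nil_bound freeH search_5_6.
- apply: ex3_berge_few => // [|H H3 _]; last exact: uniform_card_le.
  have n4 : n <= 4 by lia.
  (* At most $\binom43 = 4$ triples exist, fewer than the $\binom k2$ that a Berge clique needs. *)
  apply: leq_ltn_trans (leq_bin2l 3 n4) _.
  by case: range => -[-> _].
- by apply: ex3_berge_few => // H H3 freeH; apply: search_nil_bound freeH search_4_5.
- by apply: ex3_berge_few => // H H3 freeH; apply: search_nil_bound freeH search_5_5.
Qed.
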